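(* Let $N\ge 2$, $p\in[2,\infty[$ with $p>N$, $r_0>0$, $\lambda\in[0,C_H]$ where $C_H=\left|\frac{p-N}{p}\right|^p$, and consider the equation $$-\Delta_p u-\frac{\lambda}{|x|^p}|u|^{p-2}u=0\quad\text{in }B]r_0,\infty[.$$ Let $\alpha_\lambda\le\bar\alpha_\lambda$ be the roots in $\left[0,\frac{p-N}{p-1}\right]$ of $\alpha|\alpha|^{p-2}\big(p-N-(p-1)\alpha\big)=\lambda$. Then: (a) for every positive radial strictly monotone increasing $C^2$ strict supersolution $v$ of the equation there is $C>0$ with $|x|^{\alpha_\lambda}\le C\,v(x)$ for all $x\in B[r_0,\infty[$; (b) for every positive (not necessarily radial or increasing) $C^2$-supersolution $w$ of the equation: if $\lambda<C_H$ then $\displaystyle\limsup_{|x|\to\infty}\frac{|x|^{\bar\alpha_\lambda}}{w(x)}>0$, while if $\lambda=C_H$ then for every $\tau>0$ $$\limsup_{|x|\to\infty}\frac{|x|^{\frac{p-N}{p}}(\log|x|)^{2/p}(\log\log|x|)^\tau}{w(x)}>0.$$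
   Context: $\Delta_p u=\nabla\cdot(|\nabla u|^{p-2}\nabla u)$. $B]r_0,\infty[=\{x\in\mathbb{R}^N:|x|>r_0\}$, $B[r_0,\infty[=\{x:|x|\ge r_0\}$. A $C^2$-supersolution is a function $w\in C^2(B[r_0,\infty[)$ with $-\Delta_p w-\lambda|x|^{-p}|w|^{p-2}w\ge 0$ pointwise in $B]r_0,\infty[$; a strict supersolution has $>0$ at every point. A radial function $v(x)=\phi(|x|)$ is strictly monotone increasing if $\phi'(r)>0$ for all $r\ge r_0$. (For $0<\lambda<C_H$ there are exactly two such roots, for $\lambda=C_H$ they coincide and equal $\frac{p-N}{p}$, and for $\lambda=0$ they are $0$ and $\frac{p-N}{p-1}$.) *)

(* Defs.v *)
From HB Require Import structures.
From mathcomp Require Import all_boot all_order all_algebra.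
From mathcomp Require Import all_classical all_reals all_analysis.
Set Implicit Arguments. Unset Strict Implicit. Unset Printing Implicit Defensive.
Import Order.TTheory GRing.Theory Num.Theory.
Import numFieldNormedType.Exports.
Local Open Scope classical_set_scope.
Local Open Scope ring_scope.

Definition enorm {R : realType} {N : nat} (x : 'rV[R]_N) : R :=
  Num.sqrt (\sum_(i < N) x ord0 i ^+ 2).

Definition ev {R : realType} {N : nat} (i : 'I_N) : 'rV[R]_N := delta_mx 0 i.

Definition partial {R : realType} {N : nat} (i : 'I_N) (f : 'rV[R]_N -> R)
  (x : 'rV[R]_N) : R := derive f x (ev i).

Definition C2_open {R : realType} {N : nat} (U : set 'rV[R]_N)
  (f : 'rV[R]_N -> R) : Prop :=
  open U /\ forall x, U x ->
    [/\ {for x, continuous f},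
        (forall i, derivable f x (ev i) /\ {for x, continuous (partial i f)}) &
        (forall i j, derivable (partial i f) x (ev j) /\
                     {for x, continuous (partial j (partial i f))})].

Definition C2_on {R : realType} {N : nat} (A : set 'rV[R]_N)
  (f : 'rV[R]_N -> R) : Prop :=
  exists U : set 'rV[R]_N, A `<=` U /\ C2_open U f.

Definition Bopen {R : realType} {N : nat} (r0 : R) : set 'rV[R]_N :=
  [set x | r0 < enorm x].
Definition Bclosed {R : realType} {N : nat} (r0 : R) : set 'rV[R]_N :=
  [set x | r0 <= enorm x].

Definition gradnorm {R : realType} {N : nat} (f : 'rV[R]_N -> R) (x : 'rV[R]_N) : R :=
  Num.sqrt (\sum_(i < N) partial i f x ^+ 2).

Definition flux {R : realType} {N : nat} (p : R) (i : 'I_N)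
  (f : 'rV[R]_N -> R) (x : 'rV[R]_N) : R :=
  gradnorm f x `^ (p - 2) * partial i f x.

Definition plap {R : realType} {N : nat} (p : R) (f : 'rV[R]_N -> R)
  (x : 'rV[R]_N) : R :=
  \sum_(i < N) partial i (flux p i f) x.

Definition hardy_op {R : realType} {N : nat} (p lam : R) (w : 'rV[R]_N -> R)
  (x : 'rV[R]_N) : R :=
  - plap p w x - lam / (enorm x `^ p) * (`|w x| `^ (p - 2) * w x).

(* C^2-supersolution on B]r0,oo[ (pointwise; the divergence is required to
   exist pointwise, i.e. the flux components are differentiable in the
   relevant direction). *)
Definition supersol {R : realType} {N : nat} (p lam r0 : R)
  (w : 'rV[R]_N -> R) : Prop :=
  C2_on (Bclosed r0) w /\
  forall x, Bopen r0 x ->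
    (forall i, derivable (flux p i w) x (ev i)) /\ 0 <= hardy_op p lam w x.

Definition strict_supersol {R : realType} {N : nat} (p lam r0 : R)
  (w : 'rV[R]_N -> R) : Prop :=
  C2_on (Bclosed r0) w /\
  forall x, Bopen r0 x ->
    (forall i, derivable (flux p i w) x (ev i)) /\ 0 < hardy_op p lam w x.

Definition radial_strict_incr {R : realType} {N : nat} (r0 : R)
  (v : 'rV[R]_N -> R) : Prop :=
  exists phi : R -> R,
    (forall x, Bclosed r0 x -> v x = phi (enorm x)) /\
    (forall r, r0 <= r -> derivable phi r 1 /\ 0 < derive1 phi r).

Definition limsup_infty_pos {R : realType} {N : nat} (f : 'rV[R]_N -> R) : Prop :=
  exists2 e : R, 0 < e & forall M : R, exists x, M < enorm x /\ e < f x.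

Definition gexp {R : realType} (N : nat) (p a : R) : R :=
  a * `|a| `^ (p - 2) * (p - N%:R - (p - 1) * a).

Definition root_in {R : realType} (N : nat) (p lam a : R) : Prop :=
  0 <= a <= (p - N%:R) / (p - 1) /\ gexp N p a = lam.

(* Main.v *)
Require Import Defs.
From HB Require Import structures.
From mathcomp Require Import all_boot all_order all_algebra.
From mathcomp Require Import all_classical all_reals all_analysis.
From mathcomp Require Import ring lra.
Set Implicit Arguments. Unset Strict Implicit. Unset Printing Implicit Defensive.
Import Order.TTheory GRing.Theory Num.Theory.
Import numFieldNormedType.Exports.
Local Open Scope classical_set_scope.
Local Open Scope ring_scope.

(** In the variable s = ln r, the logarithmic slope g = r phi'(r) / phi(r) of a
    radial supersolution satisfies the Riccati inequality
    d(g ^ (p-1))/ds <= gexp g - lam.  Below a1 the right-hand side is bounded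
    away from 0, so an increasing phi cannot have slope below a1, which is (a).

    For (b), suppose that w outgrows the comparison function.  Let U be a radial
    increasing strict subsolution vanishing on |x| = r0 and dominated by the
    comparison function at infinity.  Then U / w attains a positive maximum c
    at some z with |z| > r0, and w touches U / c from above at z.  Since the
    gradient of U does not vanish, comparing first and second derivatives at z
    contradicts the pointwise inequalities; only the Hessian of w along the
    coordinate axes and along z enters.  With s = ln(r / r0), one can take
    U = e ^ (a2 s) - e ^ ((a2 - d) s) for small d > 0 when lam < C_H, and
    U = e ^ (a s) ((s + k) ^ (2/p) - k ^ (2/p)), a = (p-N)/p, k = 2/a, when
    lam = C_H.  The first is a subsolution by Bernoulli's inequality, the second
    by a Pade bound for x ^ (p-1). *)

(** * Derivatives and power inequalities *)

Lemma is_derive_addf (R : realType) (V : normedModType R) (f g : V -> R)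
    (x v : V) (df dg : R) : is_derive x v f df -> is_derive x v g dg ->
  is_derive x v (fun t => f t + g t) (df + dg).
Proof. exact: is_deriveD. Qed.

Lemma is_derive_subf (R : realType) (V : normedModType R) (f g : V -> R)
    (x v : V) (df dg : R) : is_derive x v f df -> is_derive x v g dg ->
  is_derive x v (fun t => f t - g t) (df - dg).
Proof. exact: is_deriveB. Qed.

Lemma is_derive_mulf (R : realType) (V : normedModType R) (f g : V -> R)
    (x v : V) (df dg : R) : is_derive x v f df -> is_derive x v g dg ->
  is_derive x v (fun t => f t * g t) (f x * dg + g x * df).
Proof. exact: is_deriveM. Qed.

Lemma is_derive_sumf (R : realType) (V : normedModType R) (n : nat)
    (h : 'I_n -> V -> R) (x v : V) (dh : 'I_n -> R) :
  (forall i, is_derive x v (h i) (dh i)) ->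
  is_derive x v (fun t => \sum_(i < n) h i t) (\sum_(i < n) dh i).
Proof.
move=> H; have -> : (fun t => \sum_(i < n) h i t) = \sum_(i < n) h i.
  by apply/funext => t; rewrite fct_sumE.
exact: is_derive_sum.
Qed.

(** Restricting to a line turns a directional derivative into an ordinary one, so that the chain
    rule and the mean value theorem in one variable become available in several. *)
Lemma is_derive_lineP (R : realType) (V : normedModType R) (f : V -> R)
    (x v : V) (l : R) :
  is_derive x v f l <-> is_derive (0 : R) 1 (fun t => f (t *: v + x)) l.
Proof.
have E : 'D_v f x = 'D_1 (fun t : R => f (t *: v + x)) 0.
  rewrite /derive; set g1 := fun h => h^-1 *: _; set g2 := fun h => h^-1 *: _.
  suff -> : g1 = g2 by [].
  by apply/funext => h; rewrite /g1 /g2 /= addr0 scale0r add0r [_%:A]mulr1.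
split=> -[dfx <-].
- by apply: (DeriveDef _ (esym E)); exact: (iffLR (derivable1P f x v) dfx).
- by apply: (DeriveDef _ E); exact: (iffRL (derivable1P f x v) dfx).
Qed.

Lemma is_derive_compf (R : realType) (V : normedModType R) (h : R -> R)
    (f : V -> R) (x v : V) (a b : R) :
  is_derive (f x) 1 h a -> is_derive x v f b ->
  is_derive x v (fun t => h (f t)) (a * b).
Proof.
move=> dh /is_derive_lineP df; apply/is_derive_lineP.
have := @is_derive1_comp _ h (fun t : R => f (t *: v + x)) 0 a b.
by rewrite /= scale0r add0r; apply.
Qed.

(* [apply:] would launch a class resolution on [is_derive] that may diverge. *)
Ltac derive_rules := lazymatch goal with
  | |- is_derive _ _ (fun _ => ?c) _ => exact: is_derive_cst
  | |- is_derive _ _ (fun t => t) _ => exact: is_derive_id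
  | |- is_derive _ _ (fun t => @?f t - @?g t) _ =>
      notypeclasses refine (@is_derive_subf _ _ f g _ _ _ _ _ _); derive_rules
  | |- is_derive _ _ (fun t => @?f t + @?g t) _ =>
      notypeclasses refine (@is_derive_addf _ _ f g _ _ _ _ _ _); derive_rules
  | |- is_derive _ _ (fun t => @?f t * @?g t) _ =>
      notypeclasses refine (@is_derive_mulf _ _ f g _ _ _ _ _ _); derive_rules
  | |- is_derive _ _ (fun t => expR (@?f t)) _ =>
      notypeclasses refine (@is_derive_compf _ _ (@expR _) f _ _ _ _ _ _);
      [exact: is_derive_expR|derive_rules]
  | |- is_derive _ _ (fun t => ln (@?f t)) _ =>
      notypeclasses refine (@is_derive_compf _ _ (@ln _) f _ _ _ _ _ _);
      [notypeclasses refine (is_derive1_ln _)|derive_rules]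
  | |- is_derive _ _ (fun t => (@?f t) `^ ?c) _ =>
      notypeclasses refine (@is_derive_compf _ _ (fun x => x `^ c) f _ _ _ _ _ _);
      [notypeclasses refine (is_derive1_powR c _)|derive_rules]
  | |- _ => idtac
  end.
Ltac derive_fun := notypeclasses refine (is_derive_eq _ _); [derive_rules|].

Lemma is_derive_continuous (R : realType) (f : R -> R) (x l : R) :
  is_derive x 1 f l -> {for x, continuous f}.
Proof. by case=> dfx _; apply/differentiable_continuous/derivable1_diffP. Qed.

Lemma is_derive_within_continuous (R : realType) (f df : R -> R) (a b : R) :
  (forall t, a <= t <= b -> is_derive t 1 f (df t)) ->
  {within `[a, b], continuous f}.
Proof.
move=> fdf; apply: derivable_within_continuous => t.
by rewrite in_itv => /fdf[].
Qed.

Lemma is_derive_le (R : realType) (f df : R -> R) (a b : R) : a <= b ->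
  (forall t, a < t < b -> is_derive t 1 f (df t)) ->
  (forall t, a < t < b -> 0 <= df t) ->
  {within `[a, b], continuous f} -> f a <= f b.
Proof.
rewrite le_eqVlt => /predU1P[->//|ab] fdf df0 cf.
have fdf' t : t \in `]a, b[%R -> is_derive t 1 f (df t).
  by rewrite in_itv; exact: fdf.
have [c + E] := MVT ab fdf' cf.
rewrite in_itv => /df0 dfc.
by rewrite -subr_ge0 E mulr_ge0// subr_ge0 ltW.
Qed.

(** The tangent line at [X] to the convex function [t ^ (1 + q)] lies below its graph. The proof
    uses [1 + t <= e ^ t] twice, at [q (ln Y - ln X)] and at [ln (X / Y)]. *)
Lemma powR_tangent (R : realType) (q X Y : R) : 0 <= q -> 0 < X -> 0 < Y ->
  X `^ q * ((1 + q) * Y - q * X) <= Y * Y `^ q.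
Proof.
move=> q0 X0 Y0.
have -> : Y `^ q = X `^ q * expR (q * (ln Y - ln X)).
  by rewrite /powR !gt_eqF// -expRD; congr expR; ring.
rewrite mulrCA ler_wpM2l ?powR_ge0//.
have h1 : 1 + q * (ln Y - ln X) <= expR (q * (ln Y - ln X)) := expR_ge1Dx _.
have h2 : Y * (ln X - ln Y) <= X - Y.
  rewrite -ln_div ?posrE//.
  apply: (@le_trans _ _ (Y * (X / Y - 1))); last first.
    by rewrite mulrBr mulr1 mulrCA divff ?mulr1// gt_eqF.
  rewrite ler_pM2l// lerBrDr addrC.
  have := expR_ge1Dx (ln (X / Y)).
  by rewrite lnK// posrE divr_gt0.
apply: le_trans (ler_wpM2l (ltW Y0) h1).
have := ler_wpM2l q0 h2; lra.
Qed.

(* The Pade bound [x ^ (1+q) (2 - q e) <= 2 + (2+q) e] for [x = 1 + e],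
   homogenised by [Y]; its derivative in [D] is [powR_tangent]. *)
Lemma powR_pade (R : realType) (q Y D : R) : 0 <= q -> 0 < Y -> 0 <= D ->
  (Y + D) `^ q * (Y + D) * (2 * Y - q * D)
    <= Y `^ q * Y * (2 * Y + (2 + q) * D).
Proof.
move=> q0 Y0 D0.
have powS (x : R) : 0 < x -> x `^ q * x = x `^ (1 + q).
  move=> x0; rewrite mulrC -(@mulr_powRB1 _ x (1 + q)) ?ltW//; last lra.
  by rewrite [1 + q]addrC addrK.
pose F (t : R) := Y `^ (1 + q) * (2 * Y + (2 + q) * t)
                  - (Y + t) `^ (1 + q) * (2 * Y - q * t).
pose dF (t : R) := (2 + q) * (Y * Y `^ q
   - (Y + t) `^ q * ((1 + q) * Y - q * (Y + t))).
have isF (t : R) : 0 <= t -> is_derive t 1 F (dF t).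
  move=> t0; have Yt : 0 < Y + t by lra.
  rewrite /F; derive_fun => //.
  rewrite /dF -!powS//.
  have -> : 1 + q - 1 = q by ring.
  ring.
(* Since [F 0 = 0], this is the claim. *)
have : F 0 <= F D.
  apply: (@is_derive_le _ F dF 0 D D0);
    last apply: (@is_derive_within_continuous _ F dF).
  - by move=> t /andP[/ltW t0 _]; exact: isF.
  - move=> t /andP[/ltW t0 _]; rewrite mulr_ge0 ?subr_ge0 ?powR_tangent//; lra.
  - by move=> t /andP[t0 _]; exact: isF.
rewrite /F !powS ?mulr0 ?addr0 ?subr0 ?subrr; lra.
Qed.

(** * Explicit radial subsolutions *)

(* [u (ln |x|)] is then a strict subsolution on [|x| > 1] in dimension [n],
   with zero boundary values on [|x| = 1]. *)
Definition log_subsolution {R : realType} (n p lam : R) (u u1 u2 : R -> R) :=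
  [/\ u 0 = 0,
      forall s : R, 0 <= s -> is_derive s 1 u (u1 s),
      forall s : R, 0 < s -> is_derive s 1 u1 (u2 s),
      forall s : R, 0 < s -> 0 < u s /\ 0 < u1 s &
      forall s : R, 0 < s ->
        0 < u1 s `^ (p - 2) * ((p - 1) * u2 s + (n - p) * u1 s)
            + lam * (u s `^ (p - 2) * u s)].

(** Since [p - n = p a - kap], the constant equals [a ^ (p-1) (p - n - (p-1) a)]. Once the
    exponential is factored out, the tangent bound on the zero-order term leaves a multiple of
    [- (b - a) (b - a + kap)]. The midpoint [b = a - kap / 2] of the two roots makes this positive
    and as large as possible. *)
Lemma log_subsolution_subcritical (R : realType) (n p a kap : R) :
  2 < p -> 0 < kap -> kap <= a -> p - n = p * a - kap ->
  let b := a - kap / 2 in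
  log_subsolution n p (a `^ (p - 2) * a * (a - kap))
    (fun s : R => expR (a * s) - expR (b * s))
    (fun s : R => a * expR (a * s) - b * expR (b * s))
    (fun s : R => a * a * expR (a * s) - b * b * expR (b * s)).
Proof.
move=> p2 kap0 kapa pn b.
have b0 : 0 < b by rewrite /b; lra.
have bE (s : R) : expR (b * s) = expR (a * s) * expR (- (kap / 2) * s).
  by rewrite -expRD; congr expR; rewrite /b; ring.
have r0 (s : R) : 0 < expR (- (kap / 2) * s) by exact: expR_gt0.
have r1 (s : R) : 0 < s -> expR (- (kap / 2) * s) < 1.
  by move=> s0; rewrite -[X in _ < X]expR0 ltr_expR mulNr oppr_lt0; nra.
split.
- by rewrite !mulr0 subrr.
- by move=> s _; derive_fun => /=; ring.
- by move=> s _; derive_fun => /=; ring.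
- move=> s s0; rewrite /= bE; have := r0 s; have := r1 s s0.
  have := expR_gt0 (a * s).
  move: (expR (a * s)) (expR (- (kap / 2) * s)) => E r E0 r1' r0'; split.
    by rewrite subr_gt0 gtr_pMr.
  rewrite (_ : a * E - b * (E * r) = E * (a - b * r)); last by ring.
  rewrite mulr_gt0// subr_gt0; rewrite /b; nra.
move=> s s0; rewrite /= bE; have := r0 s; have := r1 s s0.
have := expR_gt0 (a * s).
move: (expR (a * s)) (expR (- (kap / 2) * s)) => E r E0 r1' r0'.
have a0 : 0 < a by lra.
(* [X] and [Y / a] are [u1 s] and [u s] divided by [E]. *)
pose X := a - b * r; pose Y := a * (1 - r).
have X0 : 0 < X by rewrite subr_gt0; rewrite /b; nra.
have Y0 : 0 < Y by rewrite mulr_gt0 ?subr_gt0.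
have q0 : 0 <= p - 2 by lra.
have := powR_tangent q0 X0 Y0.
have -> : a * E - b * (E * r) = E * X by rewrite /X; ring.
have -> : E - E * r = E * (1 - r) by ring.
rewrite (_ : a * a * E - b * b * (E * r) = E * (a * a - b * b * r)); last by ring.
rewrite (powRM _ (ltW E0) (ltW X0)) (powRM _ (ltW E0)) ?subr_ge0 ?(ltW r1')//.
rewrite {3}/Y (powRM _ (ltW a0)) ?subr_ge0 ?(ltW r1')//.
have := powR_gt0 (p - 2) X0; have := powR_gt0 (p - 2) E0.
move: (X `^ _) (E `^ _) ((1 - r) `^ _) (a `^ _) => x e t w e0 x0 H.
set lhs := (X in 0 < X).
have -> : lhs = e * E * (x * ((p - 1) * (a * a - b * b * r) + (n - p) * X)
    + (a - kap) * (Y * (w * t))) by rewrite /lhs /Y; ring.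
rewrite mulr_gt0 ?mulr_gt0//.
(* After the tangent bound the terms without [r] cancel, and this is exactly what remains. *)
apply: (@lt_le_trans _ _ (x * (r * (p - 1) * (kap / 2) * (kap / 2)))).
  by rewrite !mulr_gt0//; lra.
have : (a - kap) * (x * ((1 + (p - 2)) * Y - (p - 2) * X))
   <= (a - kap) * (Y * (w * t)) by rewrite ler_wpM2l// subr_ge0.
have -> : n = p - p * a + kap by lra.
move=> {}H; rewrite -lerBlDl; apply: le_trans H.
rewrite le_eqVlt; apply/orP; left; apply/eqP; by rewrite /X /Y /b; field.
Qed.

(** With [Y = a psi], [D = psi1] and [W = 2 Y + p D], the Pade bound reduces the inequality to
    [0 < (p-2) a D^2 + psi2 W]. The exponent [b = 2 / p] solves [(p-2) b + 2 (b-1) = 0] and so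
    cancels the leading terms. The constant subtracted in [psi], which also gives the zero boundary
    value, makes the remainder positive. *)
Lemma log_subsolution_critical (R : realType) (n p a : R) :
  2 < p -> 0 < a -> p - n = p * a ->
  let b := 2 / p in let k := 2 / a in
  let psi (s : R) := (s + k) `^ b - k `^ b in
  let psi1 (s : R) := b * (s + k) `^ (b - 1) in
  let psi2 (s : R) := b * ((b - 1) * (s + k) `^ (b - 1 - 1)) in
  log_subsolution n p (a `^ (p - 2) * a * a)
    (fun s : R => expR (a * s) * psi s)
    (fun s : R => expR (a * s) * (a * psi s + psi1 s))
    (fun s : R => expR (a * s) * (a * a * psi s + 2 * a * psi1 s + psi2 s)).
Proof.
move=> p2 a0 pn b k psi psi1 psi2.
have p0 : 0 < p by lra.
have b0 : 0 < b by rewrite divr_gt0.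
have k0 : 0 < k by rewrite divr_gt0.
have psi_gt0 (s : R) : 0 < s -> 0 < psi s.
  by move=> s0; rewrite subr_gt0 gt0_ltr_powR// ?nnegrE; lra.
have psi1_gt0 (s : R) : 0 <= s -> 0 < psi1 s.
  by move=> s0; rewrite mulr_gt0// powR_gt0//; lra.
split.
- by rewrite /psi add0r subrr mulr0.
- by move=> s s0; rewrite /psi /psi1; derive_fun => /=; [lra|ring].
- by move=> s s0; rewrite /psi /psi1 /psi2; derive_fun => /=; [lra|lra|ring].
- move=> s s0; have := psi_gt0 s s0; have := psi1_gt0 s (ltW s0).
  by move=> ? ?; rewrite !mulr_gt0 ?expR_gt0// addr_gt0// mulr_gt0.
move=> s s0; have := psi_gt0 s s0; have := psi1_gt0 s (ltW s0).
set D := psi1 s => D0; set z := psi s => z0.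
pose Y := a * z; pose X := Y + D.
have Y0 : 0 < Y by rewrite mulr_gt0.
have X0 : 0 < X by rewrite addr_gt0.
have q0 : 0 <= p - 2 by lra.
pose W := 2 * Y + p * D.
have W0 : 0 < W by rewrite addr_gt0// mulr_gt0.
have key : 0 < (p - 2) * a * (D * D) + psi2 s * W.
  pose T := (s + k) `^ (b - 1).
  have sk0 : 0 < s + k by lra.
  have T0 : 0 < T by rewrite powR_gt0.
  have zE : z = (s + k) * T - k `^ b by rewrite /z /psi /T mulr_powRB1// ltW.
  have T2E : (s + k) `^ (b - 1 - 1) = T / (s + k).
    rewrite powRB; first by rewrite powRr1 ?(ltW sk0).
    by rewrite (gt_eqF sk0) implybT.
  (* The choice [k = 2 / a] gives [k ^ (b-1) = a k ^ b / 2], and [T <= k ^ (b-1)] because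
     [b <= 1]. *)
  have TK : T < a * k `^ b.
    apply: (@le_lt_trans _ _ (k `^ (b - 1))); last first.
      rewrite -[in ltRHS](@mulr_powRB1 _ k b) ?ltW// mulrA.
      by rewrite ltr_pMl ?powR_gt0// /k mulrCA divff ?gt_eqF//; lra.
    have b1 : b <= 1 by rewrite /b ler_pdivrMr//; lra.
    rewrite /T -[b - 1]opprB !powRN lef_pV2 ?posrE ?powR_gt0//.
    by rewrite ge0_ler_powR ?nnegrE; lra.
  have bp : p * b = 2 by rewrite /b mulrCA divff ?mulr1// gt_eqF.
  have -> : (p - 2) * a * (D * D) + psi2 s * W
      = (p - 2) * b * b * T / (s + k) * (a * k `^ b - T).
    rewrite /W /Y /psi2 T2E zE /D /psi1 -/T.
    have -> : b = 2 / p by [].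
    by field; rewrite !gt_eqF.
  by rewrite mulr_gt0 ?subr_gt0// divr_gt0// !mulr_gt0 ?invr_gt0//; lra.
have H : X `^ (p - 2) * X * (2 * Y - (p - 2) * D) <= Y `^ (p - 2) * Y * W.
  apply: le_trans (powR_pade q0 Y0 (ltW D0)) _.
  by rewrite (_ : 2 + (p - 2) = p)//; ring.
rewrite /= -/z.
have E0 := expR_gt0 (a * s); move: (expR (a * s)) E0 => E E0.
rewrite (powRM _ (ltW E0) (ltW X0)) (powRM _ (ltW E0) (ltW z0)).
have xq0 := powR_gt0 (p - 2) X0.
have eq0 := powR_gt0 (p - 2) E0.
move: H; rewrite {2}/Y (powRM _ (ltW a0) (ltW z0)) => H.
set lhs := (X in 0 < X).
have -> : lhs = E `^ (p - 2) * E
    * (X `^ (p - 2) * (- a * Y + (p - 2) * a * D + (p - 1) * psi2 s)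
       + a * (a `^ (p - 2) * z `^ (p - 2) * Y)).
  rewrite /lhs; have -> : n = p - p * a by lra.
  rewrite /X /Y; ring.
(* Multiplying by [W] clears the denominator of the Pade bound; what is left is [(p-1) X ^ (p-2)]
   times the quantity of [key]. *)
rewrite mulr_gt0 ?mulr_gt0// -(pmulr_lgt0 _ W0).
apply: (@lt_le_trans _ _ (X `^ (p - 2) * ((p - 1) *
  ((p - 2) * a * (D * D) + psi2 s * W)))).
  by rewrite !mulr_gt0//; lra.
have {}H := ler_wpM2l (ltW a0) H.
rewrite [leRHS]mulrDl -lerBlDl; apply: le_trans (le_trans H _).
  rewrite le_eqVlt; apply/orP; left; apply/eqP; rewrite /W /X; ring.
by rewrite -!mulrA.
Qed.

(** * Directional derivatives and the second derivative test *)

Lemma is_derive_cvg (R : realType) (V : normedModType R) (f : V -> R)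
    (x v : V) (l : R) :
  is_derive x v f l <->
  (fun h : R => h^-1 * (f (h *: v + x) - f x)) @ 0^' --> l.
Proof.
split=> [[dfx <-]|H]; first exact: dfx.
by apply: DeriveDef; [apply/cvg_ex; exists l | exact: cvg_lim H].
Qed.

Lemma is_derive_line_at (R : realType) (V : normedModType R) (f : V -> R)
    (x v : V) (t l : R) : is_derive (t *: v + x) v f l ->
  is_derive t 1 (fun s : R => f (s *: v + x)) l.
Proof.
move=> /is_derive_lineP H; apply/is_derive_lineP.
rewrite (_ : (fun _ => _) = (fun s : R => f (s *: v + (t *: v + x))))//.
by apply/funext => s; rewrite [_%:A]mulr1 scalerDl addrA.
Qed.

Lemma is_derive_scaledir (R : realType) (V : normedModType R) (f : V -> R)
    (x v : V) (k l : R) : is_derive x v f l -> is_derive x (k *: v) f (k * l).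
Proof.
move=> /is_derive_lineP H; apply/is_derive_lineP; rewrite mulrC.
have E : (fun t : R => f (t *: (k *: v) + x))
    = (fun t : R => (fun s : R => f (s *: v + x)) (t * k)).
  by apply/funext => s; rewrite scalerA.
rewrite E; notypeclasses refine (@is_derive_compf _ _
  (fun s : R => f (s *: v + x)) (fun t : R => t * k) _ _ _ _ _ _).
  by rewrite mul0r.
by derive_fun; rewrite mul0r add0r mulr1.
Qed.

(** The increment along [h (u + c e)] is split into a step along [h u] and a step along [h c e]. The
    mean value theorem on the second segment and continuity of the derivative along [e] give its
    limit. *)
Lemma is_derive_dirD (R : realType) (V : normedModType R) (f : V -> R)
    (x u e : V) (c l : R) :
  is_derive x u f l ->
  (\forall y \near x, derivable f y e) ->
  {for x, continuous (fun y => 'D_e f y)} ->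
  is_derive x (u + c *: e) f (l + c * 'D_e f x).
Proof.
move=> /is_derive_cvg dfu dfe cfe; apply/is_derive_cvg.
rewrite (_ : (fun _ => _) = (fun h : R => h^-1 * (f (h *: u + x) - f x) +
    h^-1 * (f (h *: (u + c *: e) + x) - f (h *: u + x)))); last first.
  by apply/funext => h; rewrite -mulrDr; congr (_ * _); ring.
apply: cvgD => //; apply/cvgrPdist_le => eps eps0.
pose eps' := eps / (1 + `|c|).
have c0 : 0 < 1 + `|c| by rewrite ltr_pwDl.
have eps'0 : 0 < eps' by rewrite divr_gt0.
have /cvgrPdist_le/(_ _ eps'0) cfe' := cfe.
have /nbhs_ballP[d /= d0 Hd] : \forall y \near x,
    derivable f y e /\ `|'D_e f x - 'D_e f y| <= eps'.
  by apply: filterI => //; exact: cfe'.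
(* For [|h| < d / K] the whole second segment stays in the ball of radius [d] around [x]. *)
pose K := `|u| + `|c| * `|e| + 1.
have K0 : 0 < K by rewrite ltr_wpDl// addr_ge0// mulr_ge0.
near=> h.
have h0 : h != 0 by near: h; exact: nbhs_dnbhs_neq.
have hK : `|h| < d / K.
  near: h; apply: nbhs_dnbhs; exists (d / K) => /=; first exact: divr_gt0.
  by move=> h; rewrite /ball/= sub0r normrN.
have inW (t : R) : 0 <= t <= 1 ->
    ball x d (t *: (h * c *: e) + (h *: u + x)).
  move=> /andP[t0 t1]; rewrite -ball_normE /ball_/=.
  rewrite addrA [_ + x]addrC opprD addrA subrr sub0r normrN.
  rewrite (le_lt_trans (ler_normD _ _))// !normrZ ?normrM.
  move: hK; rewrite ltr_pdivlMr//; apply: le_lt_trans.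
  rewrite (ger0_norm t0) /K !mulrDr mulr1 -!mulrA.
  have : 0 <= `|h| * (`|c| * `|e|) by rewrite !mulr_ge0.
  by have := normr_ge0 h; nra.
pose g (t : R) := f (t *: (h * c *: e) + (h *: u + x)).
pose dg (t : R) := h * c * 'D_e f (t *: (h * c *: e) + (h *: u + x)).
have gdg (t : R) : 0 <= t <= 1 -> is_derive t 1 g (dg t).
  move=> t01; apply: is_derive_line_at; apply: is_derive_scaledir.
  by apply: derivableP; have [] := Hd _ (inW t t01).
have gdg' (t : R) : t \in `]0, 1[%R -> is_derive t 1 g (dg t).
  by rewrite in_itv/= => /andP[t0 t1]; apply: gdg; rewrite !ltW.
have [t] := MVT ltr01 gdg' (is_derive_within_continuous gdg).
rewrite in_itv/= subr0 mulr1 => /andP[t0 t1] E.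
have -> : h *: (u + c *: e) + x = 1 *: (h * c *: e) + (h *: u + x).
  by rewrite scale1r scalerDr scalerA addrA [h *: u + _]addrC.
have g0 : f (h *: u + x) = g 0 by rewrite /g scale0r add0r.
rewrite g0 -/(g 1) E /dg !mulrA mulVf// mul1r -mulrBr normrM.
have t01 : 0 <= t <= 1 by rewrite !ltW.
have [_ /(ler_wpM2l (normr_ge0 c)) H] := Hd _ (inW t t01).
apply: (le_trans H).
by rewrite /eps' mulrCA ler_piMr ?ltW// ltr_pdivrMr// mul1r ltrDr.
Unshelve. all: by end_near. Qed.

(** Continuous partial derivatives make the directional derivative linear in the direction: the
    coordinate components of [v] are added one at a time. *)
Lemma is_derive_partials (R : realType) (N : nat) (f : 'rV[R]_N -> R)
    (x v : 'rV[R]_N) :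
  (forall i, \forall y \near x, derivable f y (ev i)) ->
  (forall i, {for x, continuous (partial i f)}) ->
  is_derive x v f (\sum_(i < N) v ord0 i * partial i f x).
Proof.
move=> df cf.
rewrite {1}(row_sum_delta v).
elim: (index_enum _) => [|i s IH].
  rewrite !big_nil; apply/is_derive_lineP.
  rewrite (_ : (fun _ => _) = cst (f x)); first exact: is_derive_cst.
  by apply/funext => t; rewrite scaler0 add0r.
rewrite !big_cons [X in is_derive _ X]addrC [X in is_derive _ _ _ X]addrC.
exact: (is_derive_dirD (v ord0 i) IH (df i) (cf i)).
Qed.

Lemma is_derive_lt0_right (R : realType) (f : R -> R) (x l : R) :
  is_derive x (1 : R) f l -> l < 0 ->
  exists2 d : R, 0 < d & forall h, 0 < h < d -> f (h + x) < f x.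
Proof.
move=> /is_derive_cvg/cvgrPdist_lt H l0.
have nl0 : 0 < - l by rewrite oppr_gt0.
have /nbhs_ballP[d /= d0 Hd] := H _ nl0.
exists d => // h /andP[h0 hd].
have hB : ball (0 : R) d h by rewrite /ball/= sub0r normrN gtr0_norm.
have hn0 : h != 0 by rewrite gt_eqF.
have := Hd h hB hn0.
rewrite [_%:A]mulr1 ltr_norml opprK => /andP[+ _].
by rewrite ltrDl oppr_gt0 pmulr_rlt0 ?invr_gt0// subr_lt0.
Qed.

(** If [l < 0] then [f1] is negative just to the right of [0], and by the mean value theorem [f]
    drops below its minimum there. Differentiability of [f1] at the single point [0] suffices. *)
Lemma second_derivative_test (R : realType) (f f1 : R -> R) (l : R) :
  (\forall t \near (0 : R), is_derive t (1 : R) f (f1 t)) ->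
  is_derive (0 : R) 1 f1 l ->
  (\forall t \near (0 : R), f 0 <= f t) -> f1 0 = 0 /\ 0 <= l.
Proof.
move=> df df1 fmin.
have /nbhs_ballP[d /= d0 Hd] : \forall t \near (0 : R),
    is_derive t (1 : R) f (f1 t) /\ f 0 <= f t by exact: filterI.
have {}Hd (t : R) : t \in `]- d, d[%R -> is_derive t 1 f (f1 t) /\ f 0 <= f t.
  rewrite in_itv/= => td; apply: Hd.
  by rewrite /ball/= sub0r normrN ltr_norml.
have df0 (t : R) : t \in `]- d, d[%R -> is_derive t 1 f (f1 t).
  by move=> /Hd[].
have o0 : 0 \in `]- d, d[%R by rewrite in_itv/= oppr_lt0 d0.
have f10 : f1 0 = 0.
  have h : is_derive (0 : R) 1 f 0.
    apply: (@derive1_at_min _ f (- d) d 0) => //; first lra.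
      by move=> t /df0[].
    by move=> t /Hd[].
  by rewrite -(@derive_val _ _ _ _ _ _ _ (df0 _ o0)) derive_val.
split=> //; rewrite leNgt; apply/negP => l0.
have [e e0 He] := is_derive_lt0_right df1 l0.
pose t := Num.min d e / 2.
have t0 : 0 < t by rewrite divr_gt0// lt_min d0.
have [td te] : t < d /\ t < e.
  have : Num.min d e <= d by rewrite ge_min lexx.
  have : Num.min d e <= e by rewrite ge_min lexx orbT.
  by move: t0; rewrite /t; lra.
have f1_lt0 (c : R) : 0 < c < t -> f1 c < 0.
  move=> /andP[c0 ct].
  by have := He c; rewrite addr0 f10 c0 (lt_trans ct)//; apply.
have dft (c : R) : c \in `]0, t[%R -> is_derive c 1 f (f1 c).
  by rewrite in_itv/= => /andP[c0 ct]; apply: df0; rewrite in_itv/=; lra.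
have cf : {within `[0, t], continuous f}.
  apply: (@is_derive_within_continuous _ f f1) => c /andP[c0 ct].
  by apply: df0; rewrite in_itv/=; lra.
have [c] := MVT t0 dft cf; rewrite in_itv/= subr0 => /f1_lt0 fc E.
have [_] : is_derive t 1 f (f1 t) /\ f 0 <= f t by apply: Hd; rewrite in_itv/=; lra.
by rewrite leNgt -subr_lt0 E nmulr_rlt0// t0.
Qed.

(** * The p-Laplacian and the touching argument *)

(** The squared gradient is a polynomial in the partial derivatives, so the weight of the flux
    becomes a real power of a differentiable function, without a square root. *)
Definition grad2 {R : realType} {N : nat} (f : 'rV[R]_N -> R) (x : 'rV[R]_N) : R :=
  \sum_(i < N) partial i f x ^+ 2.

Lemma gradnorm_powR (R : realType) (N : nat) (f : 'rV[R]_N -> R)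
    (x : 'rV[R]_N) (q : R) :
  gradnorm f x `^ q = grad2 f x `^ (2^-1 * q).
Proof.
by rewrite powRrM powR12_sqrt// sumr_ge0// => i _; rewrite sqr_ge0.
Qed.

(** This is the non-divergence form, valid where the gradient does not vanish. It involves only the
    pure second derivatives along the axes and the Hessian in the direction of the gradient. *)
Lemma plapE (R : realType) (N : nat) (p : R) (f : 'rV[R]_N -> R)
    (x : 'rV[R]_N) :
  (forall i j, derivable (partial i f) x (ev j)) -> 0 < grad2 f x ->
  plap p f x = gradnorm f x `^ (p - 2) *
    (\sum_(i < N) partial i (partial i f) x
     + (p - 2) / grad2 f x * \sum_(i < N) \sum_(k < N)
         partial i f x * partial k f x * partial i (partial k f) x).
Proof.
move=> df g0.
have dpf (k i : 'I_N) :
    is_derive x (ev i) (partial k f) (partial i (partial k f) x).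
  exact/derivableP.
have dgrad i : is_derive x (ev i) (grad2 f)
    (\sum_(k < N) 2 * partial k f x * partial i (partial k f) x).
  apply: is_derive_sumf => k.
  have -> : (fun t => partial k f t ^+ 2)
      = (fun t => partial k f t * partial k f t) by apply/funext => t; rewrite expr2.
  notypeclasses refine (is_derive_eq (is_derive_mulf (dpf k i) (dpf k i)) _).
  ring.
have dflux i : partial i (flux p i f) x = gradnorm f x `^ (p - 2) *
    (partial i (partial i f) x + (p - 2) / grad2 f x * \sum_(k < N)
       partial i f x * partial k f x * partial i (partial k f) x).
  have -> : flux p i f
      = (fun y => grad2 f y `^ (2^-1 * (p - 2)) * partial i f y).
    by apply/funext => y; rewrite /flux gradnorm_powR.
  have dpow : is_derive x (ev i) (fun y => grad2 f y `^ (2^-1 * (p - 2)))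
      (2^-1 * (p - 2) * grad2 f x `^ (2^-1 * (p - 2) - 1) *
       \sum_(k < N) 2 * partial k f x * partial i (partial k f) x).
    notypeclasses refine (@is_derive_compf _ _ (fun s : R => s `^ (2^-1 * (p - 2)))
      (grad2 f) _ _ _ _ _ (dgrad i)).
    exact: is_derive1_powR.
  rewrite {1}/partial (@derive_val _ _ _ _ _ _ _ (is_derive_mulf dpow (dpf i i))).
  rewrite gradnorm_powR.
  rewrite powRB; last by rewrite (gt_eqF g0) implybT.
  rewrite powRr1 ?(ltW g0)//.
  rewrite [X in _ = _ * (_ + _ * X)](_ : _ = partial i f x / 2 *
     \sum_(k < N) 2 * partial k f x * partial i (partial k f) x); last first.
    by rewrite mulr_sumr; apply: eq_bigr => k _; field.
  by field; rewrite gt_eqF.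
rewrite /plap (eq_bigr _ (fun i _ => dflux i)) -mulr_sumr big_split/=.
by rewrite mulr_sumr.
Qed.

Lemma ln_enorm (R : realType) (N : nat) (x : 'rV[R]_N) :
  ln (enorm x) = 2^-1 * ln (\sum_(k < N) x ord0 k ^+ 2).
Proof.
by rewrite /enorm -powR12_sqrt ?ln_powR// sumr_ge0// => k _; rewrite sqr_ge0.
Qed.

Lemma sum_sqr_line (R : realType) (N : nat) (x v : 'rV[R]_N) (t : R) :
  \sum_(k < N) (t *: v + x) ord0 k ^+ 2 =
  \sum_(k < N) x ord0 k ^+ 2 + 2 * t * \sum_(k < N) x ord0 k * v ord0 k
    + t * t * \sum_(k < N) v ord0 k ^+ 2.
Proof.
rewrite !mulr_sumr -!big_split/=; apply: eq_bigr => k _.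
rewrite !mxE; ring.
Qed.

(** On the line [x + t v] the difference between [w] and the radial function has a local minimum at
    [t = 0], and the second derivative test applies. The factors [al / A] and
    [be / A - 2 (al / A)^2] are the first and second derivatives of [ln |x + t v|] at [0]. *)
Lemma touching_second_order (R : realType) (N : nat) (U : set 'rV[R]_N)
    (w : 'rV[R]_N -> R) (x v : 'rV[R]_N) (u u1 u2 : R -> R) (s0 c : R) :
  C2_open U w -> U x -> 0 < enorm x -> s0 < ln (enorm x) ->
  (forall s : R, 0 < s -> is_derive s (1 : R) u (u1 s)) ->
  (forall s : R, 0 < s -> is_derive s (1 : R) u1 (u2 s)) ->
  (\forall y \near x, c * u (ln (enorm y) - s0) <= w y) ->
  w x = c * u (ln (enorm x) - s0) ->
  let A := \sum_(k < N) x ord0 k ^+ 2 in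
  let al := \sum_(k < N) x ord0 k * v ord0 k in
  let be := \sum_(k < N) v ord0 k ^+ 2 in
  let s := ln (enorm x) - s0 in
  \sum_(i < N) v ord0 i * partial i w x = c * u1 s * al / A /\
  c * (u2 s * (al / A) ^+ 2 + u1 s * (be / A - 2 * (al / A) ^+ 2)) <=
    \sum_(i < N) v ord0 i * \sum_(j < N) v ord0 j * partial j (partial i w) x.
Proof.
move=> [oU C2U] Ux x0 sx du du1 touch wx A al be s.
have A0 : 0 < A by rewrite -sqrtr_gt0.
have s_gt0 : 0 < s by rewrite subr_gt0.
(* [Q t] is [|x + t v|^2] and [sg t] is the shifted logarithm of [|x + t v|]. *)
pose Q (t : R) := A + 2 * t * al + t * t * be.
pose sg (t : R) := 2^-1 * ln (Q t) - s0.
have lineC : {for (0 : R), continuous (fun t : R => t *: v + x)}.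
  apply: cvgD; last exact: cvg_cst.
  by apply: cvgZr_tmp; exact: cvg_id.
have sgE (t : R) : ln (enorm (t *: v + x)) - s0 = sg t.
  by rewrite ln_enorm sum_sqr_line.
have Q0 : Q 0 = A by rewrite /Q; ring.
have sg0 : sg 0 = s by rewrite -sgE scale0r add0r.
have dQ (t : R) : is_derive t (1 : R) Q (2 * al + 2 * t * be).
  by rewrite /Q; derive_fun => /=; ring.
have dsg (t : R) : 0 < Q t -> is_derive t (1 : R) sg ((al + t * be) / Q t).
  move=> Qt; rewrite /sg; notypeclasses refine (is_derive_eq _ _);
    first by derive_rules; [exact: Qt | exact: dQ].
  by cbv beta; field; rewrite gt_eqF.
have Qnear : \forall t \near (0 : R), 0 < Q t.
  have : {for (0 : R), continuous Q} by apply: is_derive_continuous (dQ 0).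
  by move/cvgr_gt; apply; rewrite Q0.
have sgnear : \forall t \near (0 : R), 0 < sg t.
  have : {for (0 : R), continuous sg}.
    by apply: is_derive_continuous (dsg 0 _); rewrite Q0.
  by move/cvgr_gt; apply; rewrite sg0.
pose f (t : R) := w (t *: v + x) - c * u (sg t).
pose f1 (t : R) := \sum_(i < N) v ord0 i * partial i w (t *: v + x)
   - c * (u1 (sg t) * ((al + t * be) / Q t)).
have near_line (P : 'rV[R]_N -> Prop) : (\forall y \near x, P y) ->
    \forall t \near (0 : R), P (t *: v + x).
  by move=> Px; apply: (lineC); rewrite /= scale0r add0r.
have Unear : \forall y \near x, U y by exact: open_nbhs_nbhs.
pose l :=
  (\sum_(i < N) v ord0 i * (\sum_(j < N) v ord0 j * partial j (partial i w) x)
   - c * (u2 s * (al / A) ^+ 2 + u1 s * (be / A - 2 * (al / A) ^+ 2))).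
have H1 : \forall t \near (0 : R), is_derive t (1 : R) f (f1 t).
  near=> t.
  have Qt : 0 < Q t by near: t.
  have sgt : 0 < sg t by near: t.
  have Ut : U (t *: v + x) by near: t; exact: near_line.
  notypeclasses refine (is_derive_subf _ _); last first.
    notypeclasses refine (is_derive_eq (is_derive_mulf (is_derive_cst _ _ _)
      (is_derive_compf (du _ sgt) (dsg _ Qt))) _).
    by rewrite mulr0 addr0.
  apply: is_derive_line_at; apply: is_derive_partials => i; last first.
    by have [_ /(_ i)[]] := C2U _ Ut.
  have : \forall y \near t *: v + x, U y by exact: open_nbhs_nbhs.
  by apply: filterS => y Uy; have [_ /(_ i)[]] := C2U _ Uy.
have H2 : is_derive (0 : R) (1 : R) f1 l.
  notypeclasses refine (is_derive_subf _ _).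
    apply: (iffLR (is_derive_lineP
      (fun y => \sum_(i < N) v ord0 i * partial i w y) x v _)).
    apply: (@is_derive_sumf _ _ _ (fun i y => v ord0 i * partial i w y)) => i.
    have H : is_derive x v (partial i w)
       (\sum_(j < N) v ord0 j * partial j (partial i w) x).
      apply: is_derive_partials => j; last first.
        by have [_ _ /(_ i j)[]] := C2U _ Ux.
      by apply: filterS Unear => y Uy; have [_ _ /(_ i j)[]] := C2U _ Uy.
    notypeclasses refine (is_derive_eq (is_derive_mulf (is_derive_cst _ _ _) H) _).
    by rewrite mulr0 addr0.
  have Q00 : 0 < Q 0 by rewrite Q0.
  have sg00 : 0 < sg 0 by rewrite sg0.
  have dV : is_derive (0 : R) (1 : R) (fun t : R => (Q t)^-1) (- (2 * al) / A ^+ 2).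
    have QN0 : Q 0 != 0 by rewrite gt_eqF.
    notypeclasses refine (is_derive_eq (is_deriveV QN0 (dQ 0)) _).
    by rewrite Q0 /GRing.scale/=; field; rewrite gt_eqF.
  have dN : is_derive (0 : R) (1 : R) (fun t : R => al + t * be) be.
    by derive_fun => /=; ring.
  notypeclasses refine (is_derive_eq (is_derive_mulf (is_derive_cst _ _ _)
     (is_derive_mulf (is_derive_compf (du1 _ sg00) (dsg _ Q00))
     (is_derive_mulf dN dV))) _).
  by rewrite /cst sg0 Q0 mul0r addr0; field; rewrite gt_eqF.
have H3 : \forall t \near (0 : R), f 0 <= f t.
  near=> t.
  rewrite /f scale0r add0r sg0 wx subrr subr_ge0 -sgE.
  by near: t; exact: near_line touch.
have [+ +] := second_derivative_test H1 H2 H3.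
rewrite /f1 scale0r add0r sg0 Q0 mul0r addr0 /l subr_ge0 => /eqP.
by rewrite subr_eq0 => /eqP ->; rewrite !mulrA.
Unshelve. all: by end_near. Qed.

Lemma sum_ev (R : realType) (N : nat) (i : 'I_N) (F : 'I_N -> R) :
  \sum_(k < N) (ev i : 'rV[R]_N) ord0 k * F k = F i.
Proof.
rewrite (bigD1 i)//= big1 => [|k ki]; first by rewrite mxE !eqxx mul1r addr0.
by rewrite mxE (negPf ki) andbF mul0r.
Qed.

(** At a touching point both functions have the same gradient, radial and nonzero, so [plapE]
    applies to [w]. The second-order bounds along the axes and along [x] then make [plap p w x] at
    least that of the subsolution, against its strict inequality. *)
Lemma supersol_no_touching (R : realType) (N : nat) (p lam r0 s0 c : R)
    (w : 'rV[R]_N -> R) (x : 'rV[R]_N) (u u1 u2 : R -> R) :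
  2 < p -> 0 < r0 -> supersol p lam r0 w -> Bopen r0 x ->
  log_subsolution N%:R p lam u u1 u2 -> s0 < ln (enorm x) -> 0 < c ->
  (\forall y \near x, c * u (ln (enorm y) - s0) <= w y) ->
  w x <> c * u (ln (enorm x) - s0).
Proof.
move=> p2 r00 [[U [BU C2U]] sup] Bx [_ du du1 upos usub] sx c0 touch wx.
have x0 : 0 < enorm x := lt_trans r00 Bx.
have Ux : U x by apply: BU; exact: ltW Bx.
have du' (t : R) : 0 < t -> is_derive t (1 : R) u (u1 t) by move=> /ltW; exact: du.
have T v := @touching_second_order _ _ U w x v u u1 u2 s0 c
  C2U Ux x0 sx du' du1 touch wx.
have [_ hop] := sup x Bx.
move: T hop; set s := ln (enorm x) - s0 => T hop.
have s_gt0 : 0 < s by rewrite subr_gt0.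
have [us u1s] := upos s s_gt0; have := usub s s_gt0.
pose A := \sum_(k < N) x ord0 k ^+ 2.
have A0 : 0 < A by rewrite -sqrtr_gt0.
have AE : A = enorm x ^+ 2 by rewrite sqr_sqrtr// ltW.
have Dw i : partial i w x = c * u1 s * x ord0 i / A.
  have [+ _] := T (ev i); rewrite sum_ev => ->.
  by under eq_bigr do rewrite mulrC; rewrite sum_ev.
have DDw i : c * (u2 s * (x ord0 i / A) ^+ 2
    + u1 s * (1 / A - 2 * (x ord0 i / A) ^+ 2)) <= partial i (partial i w) x.
  have [_] := T (ev i).
  rewrite sum_ev (sum_ev i (fun j => partial j (partial i w) x)).
  under eq_bigr do rewrite mulrC; rewrite sum_ev.
  by under eq_bigr do rewrite expr2; rewrite sum_ev mxE !eqxx.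
(* In the direction [v = x] one has [al = be = A], so the bound reduces to [u2 - u1]. *)
have Drad : c * (u2 s - u1 s) <= \sum_(i < N) x ord0 i *
    \sum_(j < N) x ord0 j * partial j (partial i w) x.
  have [_] := T x.
  have -> : \sum_(k < N) x ord0 k * x ord0 k = A.
    by apply: eq_bigr => k _; rewrite expr2.
  rewrite divff ?gt_eqF// expr1n; apply: le_trans.
  by rewrite ler_pM2l//; lra.
have G2 : grad2 w x = (c * u1 s / enorm x) ^+ 2.
  rewrite /grad2 (eq_bigr (fun i => (c * u1 s / A) ^+ 2 * x ord0 i ^+ 2)).
    rewrite -mulr_sumr -/A AE; field; rewrite gt_eqF//.
  by move=> i _; rewrite Dw; ring.
have cu0 : 0 < c * u1 s / enorm x by rewrite divr_gt0// mulr_gt0.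
have Gn : gradnorm w x = c * u1 s / enorm x.
  by rewrite /gradnorm -/(grad2 w x) G2 sqrtr_sqr gtr0_norm.
have ddw i j : derivable (partial i w) x (ev j).
  by have [_ /(_ x Ux)[_ _ /(_ i j)[]]] := C2U.
have g20 : 0 < grad2 w x by rewrite G2 exprn_gt0.
(* As the gradient is parallel to [x], the mixed term is the Hessian along [x]. Exchanging the two
   sums matches the order of differentiation, so symmetry of the Hessian is not invoked. *)
have mixed : (p - 2) / grad2 w x * (\sum_(i < N) \sum_(k < N)
      partial i w x * partial k w x * partial i (partial k w) x)
    = (p - 2) / A * \sum_(i < N) x ord0 i *
    \sum_(j < N) x ord0 j * partial j (partial i w) x.
  rewrite exchange_big/= !mulr_sumr; apply: eq_bigr => i _.
  rewrite !mulr_sumr; apply: eq_bigr => j _.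
  rewrite !Dw G2 AE; field; rewrite !gt_eqF//.
have laplace : c / A * (u2 s + (N%:R - 2) * u1 s)
    <= \sum_(i < N) partial i (partial i w) x.
  apply: le_trans (ler_sum _ (fun i _ => DDw i)).
  have SQ : \sum_(i < N) (x ord0 i / A) ^+ 2 = A^-1.
    under eq_bigr do rewrite exprMn.
    by rewrite -mulr_suml -/A expr2 mulrA divff ?mul1r// gt_eqF.
  rewrite -mulr_sumr big_split/= -!mulr_sumr SQ sumrB sumr_const card_ord.
  rewrite -mulr_sumr SQ -mulr_natr le_eqVlt; apply/orP; left; apply/eqP.
  by field; rewrite gt_eqF.
have lower : gradnorm w x `^ (p - 2) *
    (c / A * ((p - 1) * u2 s + (N%:R - p) * u1 s)) <= plap p w x.
  rewrite (plapE p ddw g20) ler_wpM2l ?powR_ge0// mixed.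
  apply: le_trans (lerD laplace (ler_wpM2l _ Drad)); last first.
    by rewrite divr_ge0 ?(ltW A0)//; lra.
  rewrite le_eqVlt; apply/orP; left; apply/eqP.
  by field; rewrite gt_eqF.
move: hop; rewrite /hardy_op wx gtr0_norm ?mulr_gt0//.
have rp : enorm x `^ p = enorm x `^ (p - 2) * A.
  rewrite AE -{1}[p](subrK 2) [LHS]powRD; last by rewrite (gt_eqF x0) implybT.
  by rewrite (@powR_mulrn _ _ 2) ?(ltW x0).
rewrite subr_ge0 => hop sub0.
have rq0 := powR_gt0 (p - 2) x0; have cq0 := powR_gt0 (p - 2) c0.
(* This cancels the powers of [|x|] when the inequality is multiplied by [|x| ^ p]; the factor
   [c ^ (p-1)] left over comes from homogeneity. *)
have Gq : gradnorm w x `^ (p - 2) * enorm x `^ (p - 2)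
    = c `^ (p - 2) * u1 s `^ (p - 2).
  rewrite Gn -!powRM ?(ltW cu0) ?(ltW x0) ?(ltW c0) ?(ltW u1s)//.
  by rewrite divfK// gt_eqF.
have : 0 < c `^ (p - 2) * c * (u1 s `^ (p - 2) *
   ((p - 1) * u2 s + (N%:R - p) * u1 s) + lam * (u s `^ (p - 2) * u s)).
  by rewrite !mulr_gt0.
apply/negP; rewrite -leNgt.
have rqA0 : 0 < enorm x `^ p by rewrite rp mulr_gt0.
have H : gradnorm w x `^ (p - 2) *
    (c / A * ((p - 1) * u2 s + (N%:R - p) * u1 s))
    + lam / enorm x `^ p * ((c * u s) `^ (p - 2) * (c * u s)) <= 0.
  by move: lower hop; lra.
have := ler_wpM2r (ltW rqA0) H; rewrite mul0r; apply: le_trans.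
rewrite (powRM _ (ltW c0) (ltW us)) rp le_eqVlt; apply/orP; left; apply/eqP.
rewrite [LHS](_ : _ = (c `^ (p - 2) * u1 s `^ (p - 2)) *
     (c * ((p - 1) * u2 s + (N%:R - p) * u1 s))
   + c `^ (p - 2) * c * lam * (u s `^ (p - 2) * u s)); last ring.
by rewrite -Gq; field; rewrite !gt_eqF.
Qed.

(** * Compact annuli and global comparison *)

Lemma enorm_continuous (R : realType) (N : nat) :
  continuous (@enorm R N).
Proof.
move=> x; apply: (@continuous_comp _ _ _ _ (@Num.sqrt R)); last first.
  exact: sqrt_continuous.
suff H (s : seq 'I_N) : (fun y : 'rV[R]_N => \sum_(i <- s) y ord0 i ^+ 2) @ x
    --> \sum_(i <- s) x ord0 i ^+ 2 by exact: H.
elim: s => [|i s IH].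
  rewrite big_nil (_ : (fun y => _) = cst 0); first exact: cst_continuous.
  by apply/funext => y; rewrite big_nil.
rewrite big_cons expr2 (_ : (fun y => _) = (fun y : 'rV[R]_N =>
    y ord0 i * y ord0 i + \sum_(j <- s) y ord0 j ^+ 2)); last first.
  by apply/funext => y; rewrite big_cons expr2.
by apply: cvgD IH; apply: cvgM; exact: coord_continuous.
Qed.

Lemma norm_le_enorm (R : realType) (N : nat) (x : 'rV[R]_N) : `|x| <= enorm x.
Proof.
rewrite [leLHS]/Num.norm /= mx_normrE; apply: bigmax_le => [|[i j] _ /=].
  exact: sqrtr_ge0.
rewrite -sqrtr_sqr ler_wsqrtr// (ord1 i) (bigD1 j)//= lerDl.
by rewrite sumr_ge0// => k _; rewrite sqr_ge0.
Qed.

Lemma enormZ_ev (R : realType) (N : nat) (r : R) (i : 'I_N) :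
  0 <= r -> enorm (r *: ev i) = r.
Proof.
move=> r0; rewrite /enorm (bigD1 i)//= big1 => [|k ki].
  by rewrite !mxE !eqxx mulr1 addr0 sqrtr_sqr ger0_norm.
by rewrite !mxE (negPf ki) andbF mulr0 expr0n.
Qed.

Lemma annulus_compact (R : realType) (N : nat) (a b : R) :
  compact [set x : 'rV[R]_N | a <= enorm x <= b].
Proof.
apply: bounded_closed_compact.
  exists b; split; first exact: num_real.
  move=> M bM x /= /andP[_ xb].
  by rewrite (le_trans (norm_le_enorm x))// (le_trans xb)// ltW.
rewrite (_ : [set _ | _] = @enorm R N @^-1` `[a, b]); last first.
  by apply/seteqP; split => x /=; rewrite in_itv.
move/continuous_closedP: (@enorm_continuous R N); apply.
exact: interval_closed.
Qed.

(** Domination makes [u / w] small at infinity, so it attains a positive maximum over the closed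
    exterior domain. The point is not on the inner sphere, where [u] vanishes, hence it is a
    forbidden touching point. *)
Lemma log_subsolution_not_dominated (R : realType) (N : nat) (p lam r0 : R)
    (w : 'rV[R]_N -> R) (u u1 u2 : R -> R) :
  (0 < N)%N -> 2 < p -> 0 < r0 ->
  (forall x, Bclosed r0 x -> 0 < w x) -> supersol p lam r0 w ->
  log_subsolution N%:R p lam u u1 u2 ->
  ~ (forall e : R, 0 < e -> exists M : R, forall x, M < enorm x ->
       u (ln (enorm x) - ln r0) <= e * w x).
Proof.
move=> N0 p2 r00 wpos sup sub dom.
have [[U [BU C2U]] _] := sup; have [u00 du _ upos _] := sub.
pose F (x : 'rV[R]_N) := u (ln (enorm x) - ln r0) / w x.
have ln_gt (x : 'rV[R]_N) : r0 < enorm x -> 0 < ln (enorm x) - ln r0.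
  by move=> rx; rewrite subr_gt0 ltr_ln ?posrE// (lt_trans r00).
(* Any point off the inner sphere would serve: beyond [M] the quotient is at most [F x1], so a
   maximum over an annulus containing [x1] is global. *)
pose x1 : 'rV[R]_N := (2 * r0) *: ev (Ordinal N0).
have x1E : enorm x1 = 2 * r0 by rewrite enormZ_ev// mulr_ge0// ltW.
have Fpos x : r0 < enorm x -> 0 < F x.
  move=> rx; rewrite divr_gt0 ?wpos//; last exact: ltW.
  by have [] := upos _ (ln_gt x rx).
have F1 : 0 < F x1 by apply: Fpos; rewrite x1E; lra.
have [M HM] := dom _ F1.
pose b := Num.max M (2 * r0).
pose K := [set x : 'rV[R]_N | r0 <= enorm x <= b].
have K1 : K x1 by rewrite /K/= x1E le_max lexx orbT andbT; lra.
have cF : {within K, continuous F}.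
  apply: continuous_in_subspaceT => x; rewrite inE => /andP[rx _].
  have x0 : 0 < enorm x := lt_le_trans r00 rx.
  apply: (@continuousM _ _ (fun y => u (ln (enorm y) - ln r0))
    (fun y => (w y)^-1)); last first.
    apply: (@continuousV _ _ w); first by rewrite gt_eqF// wpos.
    by have [_ /(_ x (BU _ rx))[]] := C2U.
  apply: (@continuous_comp _ _ _ (fun y => ln (enorm y) - ln r0) u).
    apply: (@continuousB _ _ _ (fun y => ln (enorm y)) (cst (ln r0)));
      last exact: cst_continuous.
    apply: (@continuous_comp _ _ _ (@enorm R N) (@ln R)).
      exact: enorm_continuous.
    exact: continuous_ln.
  by apply: is_derive_continuous (du _ _); rewrite subr_ge0 ler_ln// posrE.
have [z] := EVT_max_rV (ex_intro _ x1 K1) (@annulus_compact R N r0 b) cF.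
rewrite inE => /andP[rz zb] zmax.
have F1z : F x1 <= F z by apply: zmax; rewrite inE.
have Fz : 0 < F z := lt_le_trans F1 F1z.
have rz' : r0 < enorm z.
  rewrite lt_neqAle rz andbT; apply/eqP => rzE.
  by move: Fz; rewrite /F -rzE subrr u00 mul0r ltxx.
have Fmax y : r0 < enorm y -> u (ln (enorm y) - ln r0) <= F z * w y.
  move=> ry; have wy : 0 < w y by apply: wpos; exact: ltW.
  have [yb|by_] := leP (enorm y) b.
    by rewrite -ler_pdivrMr//; apply: zmax; rewrite inE /K/= (ltW ry).
  apply: le_trans (HM y _) _; last by rewrite ler_pM2r.
  by rewrite (le_lt_trans _ by_)// le_max lexx.
have lnz : ln r0 < ln (enorm z) by rewrite -subr_gt0 ln_gt.
have Fzi : 0 < (F z)^-1 by rewrite invr_gt0.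
(* The touching function is [u] divided by the maximal value [F z]. *)
apply: (supersol_no_touching p2 r00 sup rz' sub lnz Fzi).
  have /cvgr_gt/(_ _ rz') : {for z, continuous (@enorm R N)}.
    exact: enorm_continuous.
  by apply: filterS => y ry; rewrite ler_pdivrMl// Fmax.
have wz : 0 < w z by apply: wpos.
have [uz _] := upos _ (ln_gt z rz').
by rewrite /F invf_div divfK// gt_eqF.
Qed.

(** * The exponent equation *)

Definition expo {R : realType} (n p a : R) : R :=
  a `^ (p - 1) * (p - n - (p - 1) * a).

Lemma gexpE (R : realType) (N : nat) (p a : R) : 2 < p -> 0 <= a ->
  gexp N p a = expo N%:R p a.
Proof.
move=> p2 a0; rewrite /gexp /expo ger0_norm// (_ : p - 2 = p - 1 - 1).
  by rewrite mulr_powRB1//; lra.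
by ring.
Qed.

Lemma hardy_exponent_gt0 (R : realType) (n p : R) : 2 < p -> n < p ->
  0 < (p - n) / p.
Proof. by move=> p2 np; apply: divr_gt0; lra. Qed.

Lemma expo_hardy (R : realType) (n p : R) : 2 < p -> n < p ->
  expo n p ((p - n) / p) = `|(p - n) / p| `^ p.
Proof.
move=> p2 np; have am0 := hardy_exponent_gt0 p2 np.
rewrite /expo gtr0_norm// -(@mulr_powRB1 _ _ p) ?(ltW am0)//; last lra.
by rewrite mulrC; congr (_ * _); field; lra.
Qed.

(** The tangent bound gives [g ^ (p-1) (p h - (p-1) g) <= h ^ p]. Adding [g ^ (p-1) <= h ^ (p-1)]
    times [p - n - p h], nonnegative up to the Hardy exponent, yields the claim without
    differentiating. *)
Lemma expo_ndecr (R : realType) (n p g h : R) : 2 < p -> n < p ->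
  0 < g -> g <= h -> h <= (p - n) / p -> expo n p g <= expo n p h.
Proof.
move=> p2 np g0 gh; have h0 : 0 < h := lt_le_trans g0 gh.
rewrite ler_pdivlMr; last lra.
move=> hp; have q0 : 0 <= p - 1 by lra.
have kap : 0 <= p - n - p * h by lra.
have mono : g `^ (p - 1) <= h `^ (p - 1) by rewrite ge0_ler_powR// nnegrE ltW.
have := powR_tangent q0 g0 h0; have := ler_wpM2r kap mono; rewrite /expo; lra.
Qed.

Lemma expo_continuous (R : realType) (n p a : R) : 0 < a ->
  {for a, continuous (expo n p)}.
Proof.
move=> a0; apply: (@is_derive_continuous _ _ _ (a `^ (p - 1) * - (p - 1)
   + (p - n - (p - 1) * a) * ((p - 1) * a `^ (p - 1 - 1)))).
by rewrite /expo; derive_fun => //=; ring.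
Qed.

Lemma expo_root_le (R : realType) (n p lam : R) : 2 < p -> n < p ->
  0 <= lam -> lam <= `|(p - n) / p| `^ p ->
  exists2 a, 0 <= a <= (p - n) / p & expo n p a = lam.
Proof.
move=> p2 np lam0; rewrite -expo_hardy// => lamH.
have am0 := hardy_exponent_gt0 p2 np.
have h0 : expo n p 0 = 0.
  by rewrite /expo powR0 ?mul0r//; apply/eqP; lra.
have cf : {within `[0, (p - n) / p], continuous (expo n p)}.
  apply/continuous_within_itvP => //; split.
  - by move=> t; rewrite in_itv/= => /andP[t0 _]; exact: expo_continuous.
  (* At [0] the power has only a one-sided limit here, so the value is written as a product to take
     the limit factor by factor. *)
  - have -> : expo n p 0 = 0 * (p - n - (p - 1) * 0) by rewrite h0 mul0r.
    apply: cvgM.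
      by apply: powR_cvg0; lra.
    apply: cvg_at_right_filter; apply: cvgB; first exact: cvg_cst.
    by apply: cvgM; [exact: cvg_cst|exact: cvg_id].
  - by apply: cvg_at_left_filter; exact: expo_continuous.
have [|c] := IVT (v := lam) (ltW am0) cf.
  by rewrite h0 ge_min le_max lam0 lamH orbT.
by rewrite in_itv => cam <-; exists c.
Qed.

Lemma expo_root_ge (R : realType) (n p lam : R) : 2 < p -> n < p ->
  0 <= lam -> lam <= `|(p - n) / p| `^ p ->
  exists2 a, (p - n) / p <= a <= (p - n) / (p - 1) & expo n p a = lam.
Proof.
move=> p2 np lam0; rewrite -expo_hardy// => lamH.
have am0 := hardy_exponent_gt0 p2 np.
have am_aM : (p - n) / p <= (p - n) / (p - 1).
  by rewrite ler_pM2l ?subr_gt0// lef_pV2 ?posrE; lra.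
have hM : expo n p ((p - n) / (p - 1)) = 0.
  rewrite /expo (_ : p - n - _ = 0) ?mulr0//.
  by field; lra.
have cf : {within `[(p - n) / p, (p - n) / (p - 1)], continuous (expo n p)}.
  apply: continuous_in_subspaceT => t; rewrite inE/= in_itv/= => /andP[t0 _].
  exact/expo_continuous/lt_le_trans/t0.
have [|c] := IVT (v := lam) am_aM cf.
  by rewrite hM ge_min le_max lam0 lamH orbT.
by rewrite in_itv => cam <-; exists c.
Qed.

(** * Radial increasing supersolutions *)

Lemma is_derive_coord (R : realType) (N : nat) (y v : 'rV[R]_N) (k : 'I_N) :
  is_derive y v (fun z : 'rV[R]_N => z ord0 k) (v ord0 k).
Proof.
apply/is_derive_lineP.
rewrite (_ : (fun t => _) = (fun t : R => t * v ord0 k + y ord0 k)).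
  by derive_fun => /=; ring.
by apply/funext => t; rewrite !mxE.
Qed.

Lemma is_derive_enorm (R : realType) (N : nat) (y v : 'rV[R]_N) :
  0 < enorm y ->
  is_derive y v (@enorm R N) (\sum_(k < N) v ord0 k * (y ord0 k / enorm y)).
Proof.
move=> y0; have S0 : 0 < \sum_(k < N) y ord0 k ^+ 2 by rewrite -sqrtr_gt0.
have dS : is_derive y v (fun z : 'rV[R]_N => \sum_(k < N) z ord0 k ^+ 2)
    (\sum_(k < N) 2 * (v ord0 k * y ord0 k)).
  apply: is_derive_sumf => k; under eq_fun do rewrite expr2.
  notypeclasses refine (is_derive_eq
    (is_derive_mulf (is_derive_coord _ _ _) (is_derive_coord _ _ _)) _).
  by ring.
notypeclasses refine (is_derive_eq (is_derive_compf (is_derive1_sqrt S0) dS) _).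
rewrite -/(enorm y) -mulr_sumr mulr_sumr mulr_sumr; apply: eq_bigr => k _.
by field; rewrite gt_eqF.
Qed.

Lemma near_Bopen (R : realType) (N : nat) (r0 : R) (y : 'rV[R]_N) :
  Bopen r0 y -> \forall z \near y, Bopen r0 z.
Proof.
move=> ry; have : {for y, continuous (@enorm R N)} by exact: enorm_continuous.
by move/cvgr_gt/(_ _ ry).
Qed.

(** The body of [radial_strict_incr] with the profile exposed, so that later statements can refer to
    it. *)
Definition increasing_profile {R : realType} {N : nat} (r0 : R)
    (v : 'rV[R]_N -> R) (phi : R -> R) : Prop :=
  (forall x, Bclosed r0 x -> v x = phi (enorm x)) /\
  (forall r, r0 <= r -> derivable phi r 1 /\ 0 < derive1 phi r).

Definition profile_flux {R : realType} (p : R) (phi : R -> R) (t : R) : R :=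
  derive1 phi t `^ (p - 2) * derive1 phi t.

Lemma radial_partial (R : realType) (N : nat) (r0 : R) (v : 'rV[R]_N -> R)
    (phi : R -> R) (y : 'rV[R]_N) (i : 'I_N) :
  0 < r0 -> increasing_profile r0 v phi -> Bopen r0 y ->
  partial i v y = derive1 phi (enorm y) * (y ord0 i / enorm y).
Proof.
move=> r00 prof ry; have [vphi dphi] := prof.
have y0 : 0 < enorm y := lt_trans r00 ry.
have [dy _] := dphi _ (ltW ry).
apply: derive_val; apply: (@near_eq_is_derive _ _ _ (fun z => phi (enorm z))).
  by apply: filterS (near_Bopen ry) => z rz; rewrite vphi//; exact: ltW rz.
have D : is_derive (enorm y) (1 : R) phi (derive1 phi (enorm y)).
  by rewrite derive1E; exact: derivableP.
notypeclasses refine (is_derive_eq (is_derive_compf D (is_derive_enorm _ y0)) _).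
by rewrite sum_ev.
Qed.

Lemma radial_gradnorm (R : realType) (N : nat) (r0 : R) (v : 'rV[R]_N -> R)
    (phi : R -> R) (y : 'rV[R]_N) :
  0 < r0 -> increasing_profile r0 v phi -> Bopen r0 y ->
  gradnorm v y = derive1 phi (enorm y).
Proof.
move=> r00 prof ry; have [vphi dphi] := prof.
have y0 : 0 < enorm y := lt_trans r00 ry.
have [_ dy] := dphi _ (ltW ry).
rewrite -[RHS](gtr0_norm dy) -sqrtr_sqr; congr Num.sqrt.
under eq_bigr do rewrite (radial_partial _ r00 prof)// !exprMn.
rewrite -mulr_sumr -mulr_suml exprVn sqr_sqrtr; last first.
  by rewrite sumr_ge0// => k _; rewrite sqr_ge0.
by rewrite divff ?mulr1// gt_eqF// -sqrtr_gt0.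
Qed.

Lemma radial_flux (R : realType) (N : nat) (p r0 : R) (v : 'rV[R]_N -> R)
    (phi : R -> R) (y : 'rV[R]_N) (i : 'I_N) :
  0 < r0 -> increasing_profile r0 v phi -> Bopen r0 y ->
  flux p i v y = profile_flux p phi (enorm y) * (y ord0 i / enorm y).
Proof.
move=> r00 prof ry; rewrite /flux /profile_flux (radial_gradnorm r00 prof)//.
by rewrite (radial_partial _ r00 prof)// !mulrA.
Qed.

(** Differentiability of the profile flux is read off from that of the flux component along the ray
    through [ev i0], so no second derivative of [phi] has to be introduced. *)
Lemma radial_plap (R : realType) (N : nat) (p r0 : R) (v : 'rV[R]_N -> R)
    (phi : R -> R) (r : R) (i0 : 'I_N) :
  0 < r0 -> increasing_profile r0 v phi -> r0 < r ->
  derivable (flux p i0 v) (r *: ev i0) (ev i0) ->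
  exists2 l, is_derive r (1 : R) (profile_flux p phi) l &
    plap p v (r *: ev i0) = l + (N%:R - 1) * profile_flux p phi r / r.
Proof.
move=> r00 prof rr dfl; have r_gt0 : 0 < r := lt_trans r00 rr.
set x := r *: ev i0 in dfl *.
have xr : enorm x = r by rewrite enormZ_ev// ltW.
have Bx : Bopen r0 x by rewrite /Bopen/= xr.
have xi0 : x ord0 i0 = r by rewrite !mxE !eqxx mulr1.
set F := profile_flux p phi.
pose l := partial i0 (flux p i0 v) x.
have dF : is_derive r (1 : R) F l.
  (* On this ray [y ord0 i0 / enorm y] is [1], so the flux component is the profile flux itself. *)
  apply/is_derive_lineP.
  have /is_derive_lineP : is_derive x (ev i0) (flux p i0 v) l by exact: derivableP.
  apply: near_eq_is_derive.
  near=> t.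
  have tr : r0 < t + r.
    rewrite -ltrBlDr; near: t; apply: lt_nbhsr; lra.
  have tr0 : 0 < t + r := lt_trans r00 tr.
  have E : t *: ev i0 + x = (t + r) *: ev i0 by rewrite scalerDl.
  have tE : enorm (t *: ev i0 + x) = t + r by rewrite E enormZ_ev// ltW.
  rewrite (radial_flux _ _ r00 prof) /Bopen/= tE// E !mxE !eqxx mulr1.
  rewrite divff ?mulr1 ?gt_eqF//.
  by rewrite [_%:A]mulr1.
exists l => //.
have Dflux i : partial i (flux p i v) x =
    l * (x ord0 i / r) ^+ 2 + F r * (r^-1 - x ord0 i ^+ 2 / r ^+ 3).
  apply: derive_val.
  apply: (@near_eq_is_derive _ _ _
     (fun y => F (enorm y) * (y ord0 i / enorm y))).
    by apply: filterS (near_Bopen Bx) => z rz; rewrite (radial_flux _ _ r00 prof).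
  have x0 : 0 < enorm x by rewrite xr.
  have xn0 : enorm x != 0 by rewrite gt_eqF.
  have dF' : is_derive (enorm x) (1 : R) F l by rewrite xr.
  have dn := is_derive_enorm (ev i) x0; rewrite sum_ev in dn.
  have dV : is_derive x (ev i) (fun y => (enorm y)^-1)
      (- (x ord0 i / enorm x) / enorm x ^+ 2).
    have dI : is_derive (enorm x) (1 : R) (fun t : R => t^-1)
        (- (enorm x) ^- 2 *: 1).
      exact: (@is_deriveV _ id _ _ _ xn0 (is_derive_id _ _)).
    notypeclasses refine (is_derive_eq (is_derive_compf dI dn) _).
    by rewrite /GRing.scale/=; field.
  notypeclasses refine (is_derive_eq (is_derive_mulf (is_derive_compf dF' dn)
    (is_derive_mulf (is_derive_coord _ _ _) dV)) _).
  rewrite [ev i ord0 i]mxE !eqxx /= mulr1 xr; field; rewrite gt_eqF//.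
rewrite /plap (eq_bigr _ (fun i _ => Dflux i)) big_split/= -!mulr_sumr.
have S2 : \sum_(i < N) x ord0 i ^+ 2 = r ^+ 2.
  by rewrite -xr sqr_sqrtr// sumr_ge0// => k _; rewrite sqr_ge0.
rewrite sumrB -mulr_suml S2 sumr_const card_ord.
under eq_bigr do rewrite exprMn.
rewrite -mulr_suml S2 -mulr_natr; field; rewrite gt_eqF//.
Unshelve. all: by end_near. Qed.

(** With [z = t / phi t], the power [g ^ (p-1)] is the profile flux times [z ^ (p-1)], hence
    differentiable by the product rule. *)
Lemma radial_riccati (R : realType) (N : nat) (p lam r0 r : R)
    (v : 'rV[R]_N -> R) (phi : R -> R) :
  (0 < N)%N -> 2 < p -> 0 < r0 -> (forall x, Bclosed r0 x -> 0 < v x) ->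
  increasing_profile r0 v phi -> supersol p lam r0 v -> r0 < r ->
  let g (t : R) := t * derive1 phi t / phi t in
  exists2 dy, is_derive r (1 : R) (fun t => g t `^ (p - 1)) dy &
    r * dy <= expo N%:R p (g r) - lam.
Proof.
move=> N0 p2 r00 vpos prof [_ sup] rr g.
have rr' : r0 <= r := ltW rr.
have r_gt0 : 0 < r := lt_trans r00 rr.
pose e0 := ev (Ordinal N0) : 'rV[R]_N.
have eE (t : R) : r0 <= t -> enorm (t *: e0) = t.
  by move=> rt; rewrite enormZ_ev// (le_trans _ rt)// ltW.
have [vphi dphi] := prof.
have phi_gt0 (t : R) : r0 <= t -> 0 < phi t.
  move=> rt; have Bt : Bclosed r0 (t *: e0) by rewrite /Bclosed/= eE.
  by have := vpos _ Bt; rewrite vphi// eE.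
have Bx : Bopen r0 (r *: e0) by rewrite /Bopen/= eE// ltW.
have [dfl hop] := sup _ Bx.
have [l dF plapE] := radial_plap r00 prof rr (dfl (Ordinal N0)).
have [dphir d_gt0] := dphi _ (ltW rr).
have f_gt0 := phi_gt0 _ (ltW rr).
have Dphi : is_derive r (1 : R) phi (derive1 phi r).
  by rewrite derive1E; exact: derivableP.
pose z (t : R) := t / phi t.
have z_gt0 (t : R) : r0 <= t -> 0 < z t.
  by move=> rt; rewrite divr_gt0 ?phi_gt0// (lt_le_trans r00).
have fn0 : phi r != 0 by rewrite gt_eqF.
have Dz : is_derive r (1 : R) z ((phi r)^-1 * (1 - g r)).
  notypeclasses refine (is_derive_eq
    (is_derive_mulf (is_derive_id _ _) (is_deriveV fn0 Dphi)) _).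
  by rewrite /g /GRing.scale/=; field.
have zr := z_gt0 _ (ltW rr).
have DZ : is_derive r (1 : R) (fun t => z t `^ (p - 1))
    ((p - 1) * z r `^ (p - 1 - 1) * ((phi r)^-1 * (1 - g r))).
  exact: (is_derive_compf (is_derive1_powR _ zr) Dz).
have powS (x : R) : 0 < x -> x `^ (p - 1) = x `^ (p - 2) * x.
  move=> x0; rewrite mulrC (_ : p - 2 = p - 1 - 1); last by ring.
  by rewrite mulr_powRB1 ?ltW//; lra.
have gE (t : R) : r0 < t ->
    profile_flux p phi t * z t `^ (p - 1) = g t `^ (p - 1).
  move=> rt; have [_ dt] := dphi _ (ltW rt).
  rewrite /profile_flux -powS// -powRM ?(ltW dt) ?(ltW (z_gt0 _ (ltW rt)))//.
  by congr (_ `^ _); rewrite /g /z; ring.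
have Dy := is_derive_mulf dF DZ.
exists (profile_flux p phi r * ((p - 1) * z r `^ (p - 1 - 1)
    * ((phi r)^-1 * (1 - g r))) + z r `^ (p - 1) * l).
  apply: near_eq_is_derive Dy; near=> t.
  by apply: gE; near: t; exact: lt_nbhsr.
move: hop; rewrite /hardy_op plapE eE// vphi /Bclosed/= eE//.
rewrite (gtr0_norm f_gt0) -powS//.
set F := profile_flux p phi r; set n : R := N%:R => hop.
have zphi : z r * phi r = r by rewrite /z divfK.
have rp : r `^ p = r * r `^ (p - 1) by rewrite mulr_powRB1 ?ltW//; lra.
(* Multiplying the supersolution inequality by [r z ^ (p-1)] turns the flux into [g ^ (p-1)] and,
   since [z phi = r], the potential term into [lam]. *)
have w_gt0 : 0 < r * z r `^ (p - 1) by rewrite mulr_gt0// powR_gt0.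
have := mulr_ge0 (ltW w_gt0) hop.
have -> : r * z r `^ (p - 1) *
    (- (l + (n - 1) * F / r) - lam / r `^ p * phi r `^ (p - 1))
  = - (r * (z r `^ (p - 1) * l)) - (n - 1) * (F * z r `^ (p - 1))
    - lam * ((z r `^ (p - 1) * phi r `^ (p - 1)) / r `^ (p - 1)).
  by rewrite rp; field; rewrite !gt_eqF// powR_gt0.
rewrite -(powRM _ (ltW zr) (ltW f_gt0)) zphi divff ?gt_eqF ?powR_gt0// mulr1.
have -> : r * (F * ((p - 1) * z r `^ (p - 1 - 1) * ((phi r)^-1 * (1 - g r)))
    + z r `^ (p - 1) * l)
  = (p - 1) * (1 - g r) * (F * z r `^ (p - 1)) + r * (z r `^ (p - 1) * l).
  have zE : z r `^ (p - 1) = z r `^ (p - 1 - 1) * (r / phi r).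
    by rewrite -/(z r) [RHS]mulrC mulr_powRB1 ?ltW//; lra.
  by rewrite mulrDr; congr (_ + _); rewrite zE; ring.
rewrite /F gE// /expo; lra.
Unshelve. all: by end_near. Qed.

(** A slope below [a] at [r] would stay below its value there, because [expo] is nondecreasing up to
    the Hardy exponent. Then [t y'(t) <= - d] for all later [t], and [y] would become nonpositive in
    finite time. *)
Lemma log_slope_ge (R : realType) (N : nat) (p lam r0 a r : R)
    (v : 'rV[R]_N -> R) (phi : R -> R) :
  (0 < N)%N -> 2 < p -> N%:R < p -> 0 < r0 ->
  (forall x, Bclosed r0 x -> 0 < v x) ->
  increasing_profile r0 v phi -> supersol p lam r0 v ->
  a <= (p - N%:R) / p ->
  (forall b, 0 < b -> b < a -> expo N%:R p b < lam) -> r0 < r ->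
  a <= r * derive1 phi r / phi r.
Proof.
move=> N0 p2 Np r00 vpos prof sup aam alt rr.
pose g (t : R) := t * derive1 phi t / phi t; rewrite -/(g r).
pose y (t : R) := g t `^ (p - 1).
have g_gt0 (t : R) : r0 < t -> 0 < g t.
  move=> rt; have t0 := lt_trans r00 rt.
  have [vphi /(_ t (ltW rt))[_ dt]] := prof.
  rewrite divr_gt0 ?mulr_gt0//.
  have tE : enorm (t *: (ev (Ordinal N0) : 'rV[R]_N)) = t.
    by rewrite enormZ_ev// ltW.
  have Bt : Bclosed r0 (t *: (ev (Ordinal N0) : 'rV[R]_N)).
    by rewrite /Bclosed/= tE ltW.
  by have := vpos _ Bt; rewrite vphi// tE.
have y_gt0 (t : R) : r0 < t -> 0 < y t by move=> /g_gt0; exact: powR_gt0.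
have Dy (t : R) : r0 < t -> is_derive t (1 : R) y (derive1 y t) /\
    t * derive1 y t <= expo N%:R p (g t) - lam.
  move=> rt; have [l Dl ll] := radial_riccati N0 p2 r00 vpos prof sup rt.
  by rewrite derive1E (@derive_val _ _ _ _ _ _ _ Dl).
rewrite leNgt; apply/negP => gra.
set d := lam - expo N%:R p (g r).
have d0 : 0 < d by rewrite subr_gt0 alt// g_gt0.
have small (t : R) : r0 < t -> y t <= y r -> t * derive1 y t <= - d.
  move=> rt yt; have [_ /le_trans] := Dy t rt; apply.
  rewrite opprB lerD2r; apply: expo_ndecr => //; first exact: g_gt0.
    rewrite leNgt; apply/negP => grt; move: yt; apply/negP; rewrite -ltNge.
    by rewrite gt0_ltr_powR ?nnegrE ?(ltW (g_gt0 _ _))//; lra.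
  exact: le_trans (ltW gra) aam.
(* The minimum of [y] on [[r, T]] lies at [T]: at an earlier minimum point the derivative would be
   negative, and [y] would decrease further. *)
have bounded (T : R) : r <= T -> y T <= y r.
  move=> rT.
  have cf : {within `[r, T], continuous y}.
    apply: (@is_derive_within_continuous _ y (derive1 y)) => t /andP[rt _].
    by have [] := Dy t (lt_le_trans rr rt).
  have [c] := EVT_min rT cf; rewrite in_itv/= => /andP[rc cT] cmin.
  have rc' := lt_le_trans rr rc.
  have yc : y c <= y r by apply: cmin; rewrite in_itv/= lexx.
  move: cT; rewrite le_eqVlt => /predU1P[<-//|cT].
  have [Dc _] := Dy c rc'.
  have dc : derive1 y c < 0.
    rewrite -(pmulr_rlt0 _ (lt_trans r00 rc')).
    by apply: le_lt_trans (small c rc' yc) _; rewrite oppr_lt0.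
  have [e e0 He] := is_derive_lt0_right Dc dc.
  pose h := Num.min e (T - c) / 2.
  have h0 : 0 < h by rewrite divr_gt0// lt_min e0 subr_gt0.
  have [he hT] : h < e /\ h < T - c.
    have : Num.min e (T - c) <= e by rewrite ge_min lexx.
    have : Num.min e (T - c) <= T - c by rewrite ge_min lexx orbT.
    by move: h0; rewrite /h; lra.
  have := He h; rewrite h0 he => /(_ isT).
  rewrite ltNge cmin// in_itv/=; lra.
have decay (T : R) : r <= T -> y T + d * ln T <= y r + d * ln r.
  move=> rT; rewrite -lerN2.
  have Df (t : R) : r0 < t -> is_derive t (1 : R) (fun t => 0 - (y t + d * ln t))
      (- (derive1 y t + d / t)).
    move=> rt; have [Dt _] := Dy t rt.
    notypeclasses refine (is_derive_eq _ _).
      notypeclasses refine (is_derive_subf (is_derive_cst _ _ _)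
        (is_derive_addf Dt (is_derive_mulf (is_derive_cst _ _ _)
          (is_derive1_ln (lt_trans r00 rt))))).
    by rewrite /cst mulr0 addr0 sub0r.
  have := @is_derive_le _ (fun t => 0 - (y t + d * ln t))
    (fun t => - (derive1 y t + d / t)) r T rT.
  rewrite !sub0r; apply.
  - by move=> t /andP[rt _]; apply: Df; exact: lt_trans rt.
  - move=> t /andP[rt _]; have rt' := lt_trans rr rt.
    have t0 := lt_trans r00 rt'.
    rewrite oppr_ge0 -(pmulr_rle0 _ t0) mulrDr mulrCA divff ?gt_eqF// mulr1.
    by have := small t rt' (bounded t (ltW rt)); lra.
  - apply: (@is_derive_within_continuous _ _ (fun t => - (derive1 y t + d / t))).
    by move=> t /andP[rt _]; apply: Df; exact: lt_le_trans rt.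
have r_gt0 := lt_trans r00 rr.
(* With this [T], [d (ln T - ln r) = y r], so [decay] forces [y T <= 0]. *)
pose T := r * expR (y r / d).
have rT : r <= T.
  by rewrite ler_peMr ?(ltW r_gt0)// -expR0 ler_expR divr_ge0// ltW// y_gt0.
have := decay T rT.
rewrite /T lnM ?posrE ?expR_gt0// expRK mulrDr [d * (_ / d)]mulrC divfK ?gt_eqF//.
have := y_gt0 T (lt_le_trans rr rT); rewrite /T; lra.
Qed.

(** By the slope bound [ln phi - a ln t] is nondecreasing; the constant [C] gives equality on the
    inner sphere. *)
Lemma radial_supersol_ge (R : realType) (N : nat) (p lam r0 a : R)
    (v : 'rV[R]_N -> R) (phi : R -> R) :
  (0 < N)%N -> 2 < p -> N%:R < p -> 0 < r0 ->
  (forall x, Bclosed r0 x -> 0 < v x) ->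
  increasing_profile r0 v phi -> supersol p lam r0 v ->
  a <= (p - N%:R) / p ->
  (forall b, 0 < b -> b < a -> expo N%:R p b < lam) ->
  exists2 C : R, 0 < C &
    forall x, Bclosed r0 x -> enorm x `^ a <= C * v x.
Proof.
move=> N0 p2 Np r00 vpos prof sup aam alt.
have [vphi dphi] := prof.
have phi_gt0 (t : R) : r0 <= t -> 0 < phi t.
  move=> rt; have t0 := lt_le_trans r00 rt.
  have tE : enorm (t *: (ev (Ordinal N0) : 'rV[R]_N)) = t.
    by rewrite enormZ_ev// ltW.
  have Bt : Bclosed r0 (t *: (ev (Ordinal N0) : 'rV[R]_N)).
    by rewrite /Bclosed/= tE.
  by have := vpos _ Bt; rewrite vphi// tE.
have f0 := phi_gt0 _ (lexx r0).
exists (r0 `^ a / phi r0); first by rewrite divr_gt0// powR_gt0.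
move=> x rx; rewrite vphi//.
set r := enorm x in rx *; have rx' : r0 <= r := rx.
have r_gt0 := lt_le_trans r00 rx'; have fr := phi_gt0 _ rx'.
have Df (t : R) : r0 <= t -> is_derive t (1 : R)
    (fun t => ln (phi t) - a * ln t) ((phi t)^-1 * derive1 phi t - a / t).
  move=> rt; have [dt _] := dphi t rt.
  have Dphi : is_derive t (1 : R) phi (derive1 phi t).
    by rewrite derive1E; exact: derivableP.
  notypeclasses refine (is_derive_eq _ _).
    notypeclasses refine (is_derive_subf
      (is_derive_compf (is_derive1_ln (phi_gt0 _ rt)) Dphi)
      (is_derive_mulf (is_derive_cst _ _ _)
        (is_derive1_ln (lt_le_trans r00 rt)))).
  by rewrite /cst mulr0 addr0.
have : ln (phi r0) - a * ln r0 <= ln (phi r) - a * ln r.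
  apply: (@is_derive_le _ (fun t => ln (phi t) - a * ln t)
     (fun t => (phi t)^-1 * derive1 phi t - a / t) r0 r rx').
  - by move=> t /andP[/ltW rt _]; exact: Df.
  - move=> t /andP[rt _]; have t0 := lt_trans r00 rt.
    have := log_slope_ge N0 p2 Np r00 vpos prof sup aam alt rt.
    rewrite subr_ge0 ler_pdivrMr// => /le_trans; apply.
    by rewrite le_eqVlt; apply/orP; left; apply/eqP; ring.
  - apply: (@is_derive_within_continuous _ _
      (fun t => (phi t)^-1 * derive1 phi t - a / t)) => t /andP[rt _].
    exact: Df.
move=> H; rewrite mulrAC ler_pdivlMr//.
rewrite -ler_ln ?posrE ?mulr_gt0 ?powR_gt0//.
rewrite !lnM ?posrE ?powR_gt0// !ln_powR; lra.
Qed.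

(** * Growth at infinity and the theorem *)

Lemma limsup_pos_of_log_subsolution (R : realType) (N : nat)
    (p lam r0 K M0 : R) (w f : 'rV[R]_N -> R) (u u1 u2 : R -> R) :
  (0 < N)%N -> 2 < p -> 0 < r0 ->
  (forall x, Bclosed r0 x -> 0 < w x) -> supersol p lam r0 w ->
  log_subsolution N%:R p lam u u1 u2 -> 0 < K ->
  (forall x, M0 < enorm x -> u (ln (enorm x) - ln r0) <= K * f x) ->
  limsup_infty_pos (fun x => f x / w x).
Proof.
move=> N0 p2 r00 wpos sup sub K0 uf; apply: contrapT => nlim.
apply: (log_subsolution_not_dominated N0 p2 r00 wpos sup sub) => e e0.
(* If the limsup is not positive, [f / w] is eventually below every positive bound; the level
   [e / K] absorbs the constant in [u <= K f]. *)
have [M HM] : exists M : R, forall x, M < enorm x -> f x / w x <= e / K.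
  apply: contrapT => nM; apply: nlim; exists (e / K); first exact: divr_gt0.
  move=> M; apply: contrapT => nx; apply: nM; exists M => x Mx.
  by rewrite leNgt; apply/negP => ?; apply: nx; exists x.
exists (Num.max r0 (Num.max M0 M)) => x; rewrite !gt_max => /and3P[rx M0x Mx].
have wx : 0 < w x by apply: wpos; exact: ltW.
apply: le_trans (uf x M0x) _; rewrite mulrC -ler_pdivlMr//.
by have := HM x Mx; rewrite ler_pdivrMr// mulrAC.
Qed.

Lemma expR_log_ratio (R : realType) (a r r0 : R) : 0 < r0 -> 0 < r ->
  expR (a * (ln r - ln r0)) = (r0 `^ a)^-1 * r `^ a.
Proof.
move=> r00 r_gt0; rewrite /powR !gt_eqF// -expRN -expRD; congr expR; ring.
Qed.

Theorem theorem4p2 (R : realType) (N : nat) (p r0 lam a1 a2 : R) :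
  (2 <= N)%N -> 2 <= p -> N%:R < p -> 0 < r0 ->
  0 <= lam -> lam <= `|(p - N%:R) / p| `^ p ->
  (* a1 = alpha_lambda (smallest root), a2 = bar alpha_lambda (largest root) *)
  root_in N p lam a1 -> root_in N p lam a2 ->
  (forall a, root_in N p lam a -> a1 <= a /\ a <= a2) ->
  (* (a) *)
  (forall v : 'rV[R]_N -> R,
     (forall x, Bclosed r0 x -> 0 < v x) ->
     radial_strict_incr r0 v ->
     strict_supersol p lam r0 v ->
     exists2 C : R, 0 < C &
       forall x, Bclosed r0 x -> enorm x `^ a1 <= C * v x) /\
  (* (b) *)
  (forall w : 'rV[R]_N -> R,
     (forall x, Bclosed r0 x -> 0 < w x) ->
     supersol p lam r0 w ->
     (lam < `|(p - N%:R) / p| `^ p ->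
        limsup_infty_pos (fun x => enorm x `^ a2 / w x)) /\
     (lam = `|(p - N%:R) / p| `^ p ->
        forall tau : R, 0 < tau ->
          limsup_infty_pos (fun x =>
            enorm x `^ ((p - N%:R) / p) * ln (enorm x) `^ (2 / p)
            * ln (ln (enorm x)) `^ tau / w x))).
Proof.
move=> N2 _ Np r00 lam0 lamH [/andP[a10 a1M] Ga1] [/andP[a20 a2M] Ga2] roots.
have N0 : (0 < N)%N := ltnW N2.
(* From [2 <= N < p] the inequality is strict. *)
have p2 : 2 < p by rewrite (le_lt_trans _ Np)// (ler_nat _ 2).
have p0 : 0 < p by lra.
have am0 := hardy_exponent_gt0 p2 Np.
have amM : (p - N%:R) / p <= (p - N%:R) / (p - 1).
  by rewrite ler_pM2l ?subr_gt0// lef_pV2 ?posrE; lra.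
rewrite gexpE// in Ga1; rewrite gexpE// in Ga2.
have root b : 0 <= b -> b <= (p - N%:R) / (p - 1) -> expo N%:R p b = lam ->
    a1 <= b /\ b <= a2.
  by move=> b0 bM Gb; apply: roots; split; [rewrite b0|rewrite gexpE].
(* The intermediate value theorem gives a root on each side of the Hardy exponent, and [a1], [a2]
   are the extreme roots. *)
have a1am : a1 <= (p - N%:R) / p.
  have [c /andP[c0 cam] Gc] := expo_root_le p2 Np lam0 lamH.
  have [a1c _] := root c c0 (le_trans cam amM) Gc.
  exact: le_trans a1c cam.
have a2am : (p - N%:R) / p <= a2.
  have [c /andP[amc cM] Gc] := expo_root_ge p2 Np lam0 lamH.
  have [_ ca2] := root c (le_trans (ltW am0) amc) cM Gc.
  exact: le_trans amc ca2.
have powS (x : R) : 0 < x -> x `^ (p - 1) = x `^ (p - 2) * x.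
  move=> x0; rewrite mulrC (_ : p - 2 = p - 1 - 1); last by ring.
  by rewrite mulr_powRB1 ?ltW//; lra.
split.
  move=> v vpos [phi prof] [C2v sup].
  apply: (radial_supersol_ge N0 p2 Np r00 vpos prof (lam := lam)) => //.
    by split=> // x Bx; have [dfl /ltW] := sup x Bx.
  (* Below [a1] the monotone [expo] is at most [lam], and equality would be a smaller root. *)
  move=> b b0 ba; rewrite lt_neqAle -{2}Ga1 expo_ndecr ?(ltW ba)// andbT.
  apply/eqP => Gb; have [] := root b (ltW b0) _ Gb.
    exact: le_trans (ltW ba) a1M.
  by rewrite leNgt ba.
move=> w wpos sup; split.
  move=> lamlt.
  have a2am' : (p - N%:R) / p < a2.
    rewrite lt_neqAle a2am andbT; apply/eqP => a2E.
    by move: lamlt; rewrite -Ga2 -a2E expo_hardy// ltxx.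
  have a2_gt0 := lt_trans am0 a2am'.
  pose kap := p * a2 - (p - N%:R).
  have kap0 : 0 < kap by rewrite subr_gt0 mulrC -ltr_pdivrMr.
  (* This is [a2 <= (p - N) / (p - 1)] rearranged. *)
  have kapa : kap <= a2.
    by move: a2M; rewrite /kap ler_pdivlMr; [move: (N%:R : R) => n|]; lra.
  have pn : p - N%:R = p * a2 - kap by rewrite /kap; ring.
  have lamE : lam = a2 `^ (p - 2) * a2 * (a2 - kap).
    by rewrite -Ga2 /expo powS// pn; congr (_ * _); ring.
  rewrite lamE in sup.
  apply: (limsup_pos_of_log_subsolution (K := (r0 `^ a2)^-1) (M0 := r0)
    N0 p2 r00 wpos sup
    (log_subsolution_subcritical p2 kap0 kapa pn)).
    by rewrite invr_gt0 powR_gt0.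
  (* The subtracted exponential is dropped; the factor [r0 ^ (- a2)] accounts for the shift by
     [ln r0]. *)
  move=> x rx; rewrite -expR_log_ratio//; last exact: lt_trans rx.
  by rewrite lerBlDr lerDl expR_ge0.
move=> lamE tau tau0.
set a := (p - N%:R) / p in lamE am0 *.
have pn : p - N%:R = p * a by rewrite /a mulrC divfK// gt_eqF.
have lamE' : lam = a `^ (p - 2) * a * a.
  by rewrite lamE gtr0_norm// -(@mulr_powRB1 _ _ p) ?(ltW am0)// powS// mulrC.
rewrite lamE' in sup.
pose k := 2 / a; pose b := 2 / p.
have b0 : 0 < b by rewrite divr_gt0.
have k0 : 0 < k by rewrite divr_gt0.
(* Once [ln |x|] exceeds [L], [ln (ln |x|) >= 1], so the [tau] factor is at least [1]; also
   [s + k <= 2 ln |x|], the source of [2 ^ b] in [K]. *)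
pose L := Num.max (expR 1) (k - ln r0).
apply: (limsup_pos_of_log_subsolution (K := (r0 `^ a)^-1 * 2 `^ b)
  (M0 := Num.max r0 (expR L)) N0 p2 r00 wpos sup
  (log_subsolution_critical p2 am0 pn)).
  by rewrite mulr_gt0 ?invr_gt0 ?powR_gt0.
move=> x; rewrite gt_max => /andP[rx Lx].
have x0 : 0 < enorm x := lt_trans r00 rx.
have : L < ln (enorm x) by rewrite -ltr_expR lnK.
rewrite gt_max => /andP[eL kL].
have l0 : 0 < ln (enorm x) := lt_trans (expR_gt0 1) eL.
have s0 : 0 < ln (enorm x) - ln r0 by rewrite subr_gt0 ltr_ln.
rewrite -/b -/k expR_log_ratio//.
have sk : (ln (enorm x) - ln r0 + k) `^ b - k `^ b <= 2 `^ b * ln (enorm x) `^ b.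
  rewrite -powRM ?(ltW l0)// lerBlDr ler_wpDr ?powR_ge0//.
  by rewrite ge0_ler_powR ?nnegrE; lra.
have tau1 : 1 <= ln (ln (enorm x)) `^ tau.
  have -> : 1 = 1 `^ tau :> R by rewrite powR1.
  have : 1 <= ln (ln (enorm x)) by rewrite -ler_expR lnK// ltW.
  by move=> ll; rewrite ge0_ler_powR ?nnegrE ?(ltW tau0)//; lra.
rewrite -!mulrA; apply: ler_wpM2l; first by rewrite invr_ge0 powR_ge0.
rewrite [leRHS]mulrCA; apply: ler_wpM2l; first exact: powR_ge0.
apply: le_trans sk _; rewrite ler_wpM2l ?powR_ge0//.
by rewrite ler_peMr ?powR_ge0.
Qed.
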